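(* For integers $n>m\ge 1$ and any prime power $q$, writing $u=n/m$, we have $$ r(n,m)=\lambda_q(m)\, e^\gamma\, \omega(u)\left(1+O\left(\frac{(u/e)^{-u}}{m}\right)\right),$$ and $$ \lambda_q(m)=e^{-H_m}\left(1+O\left(\frac{1}{m q^{(m+1)/2}}\right)\right)=\frac{e^{-\gamma}}{m}\left(1+O\left(\frac1m\right)\right),$$ where $H_m=\sum_{1\le k\le m}\frac1k$. The implied constants are absolute.
   Context: $\mathbb{F}_q$ is the finite field with $q$ elements. For integers $n\ge1$, $m\ge 0$, $r(n,m)$ denotes the proportion, among the $q^n$ monic polynomials of degree $n$ over $\mathbb{F}_q$, of those all of whose non-constant divisors have degree $>m$. $I_k$ denotes the number of monic irreducible polynomials of degree $k$ over $\mathbb{F}_q$, and $\lambda_q(m)=\prod_{k=1}^m (1-q^{-k})^{I_k}$. $\gamma$ is Euler's constant. Buchstab's function $\omega$ is defined by $\omega(u)=0$ for $u<1$, $\omega(u)=1/u$ for $1\le u\le 2$, and for $u\ge1$ it is the unique continuous function satisfying $(u\omega(u))'=\omega(u-1)$ for $u>2$. *)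

(* Defs.v *)
From HB Require Import structures.
From mathcomp Require Import all_boot all_order all_algebra.
From mathcomp Require Import all_classical all_reals all_analysis.
From mathcomp Require Import lra ring.
Import Order.TTheory GRing.Theory Num.Theory.
Import numFieldNormedType.Exports.

Set Implicit Arguments.
Unset Strict Implicit.
Unset Printing Implicit Defensive.

Local Open Scope ring_scope.

(* F plays the role of F_q, with q = #|F|. *)
Section polynomial_counts.
Variable F : finFieldType.

Definition monics (n : nat) : {set {poly_n.+1 F}} :=
  [set p : {poly_n.+1 F} | ((p : {poly F}) \is monic) && (size p == n.+1)]%SET.

(* [irreducibleb] is the boolean version of [irreducible_poly]. *)
Definition num_irr (k : nat) : nat :=
  #|[set p in monics k | irreducibleb (p : {poly F})]%SET|.

(* [size d] is one plus the degree of [d]. *)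
Definition rough (m : nat) (p : {poly F}) : Prop :=
  forall d : {poly F}, d %| p -> (1 < size d)%N -> (m.+1 < size d)%N.

Variable R : realType.

Definition rough_prop (n m : nat) : R :=
  #|[set p in monics n | `[< rough m p >]]%SET|%:R / #|monics n|%:R.

Definition lambda (m : nat) : R :=
  \prod_(1 <= k < m.+1) (1 - #|F|%:R ^- k) ^+ num_irr k.

End polynomial_counts.

Lemma card_monics (F : finFieldType) n : #|monics F n| = (#|F| ^ n)%N.
Proof.
rewrite -card_npoly.
pose f (p : {poly_n F}) : {poly_n.+1 F} := npolyp n.+1 ('X^n + (p : {poly F})).
have fE p : (f p : {poly F}) = 'X^n + (p : {poly F}).
  apply/polyP => i; rewrite coef_npolyp; case: ltnP => // ni.
  by rewrite coefD coefXn gtn_eqF ?nth_default ?addr0// (leq_trans (size_npoly p) (ltnW ni)).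
have f_inj : injective f.
  move=> p r /(congr1 (fun x : {poly_n.+1 F} => (x : {poly F}))).
  by rewrite !fE => /addrI/val_inj.
rewrite -(card_imset _ f_inj); apply: eq_card => p.
apply/idP/imsetP => [|[r _ ->]]; rewrite !inE; last first.
  by rewrite !fE monicE lead_coefDl ?lead_coefXn ?size_polyDl ?size_polyXn ?eqxx ?ltnS ?size_npoly.
move=> /andP[pm /eqP sp].
exists (npolyp n ((p : {poly F}) - 'X^n)) => //.
apply/val_inj; rewrite /= fE; apply/polyP => i.
rewrite coefD coef_npolyp coefB coefXn.
case: (ltngtP i n) => ni; rewrite ?add0r ?subr0 ?addr0//.
  by rewrite nth_default// sp.
by rewrite ni; move/monicP: pm; rewrite /lead_coef sp.
Qed.

Local Open Scope classical_set_scope.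

Section analytic.
Variable R : realType.

Definition harm (m : nat) : R := \sum_(1 <= k < m.+1) k%:R^-1.

(* [ln 0 = 0] here, so the term of index 0 is harmless. *)
Definition euler_gamma : R := limn (fun n : nat => harm n - ln n%:R).

Definition is_buchstab (w : R -> R) : Prop :=
  [/\ forall u, u < 1 -> w u = 0,
      forall u, 1 <= u <= 2 -> w u = u^-1,
      {within `[1, +oo[, continuous w} &
      forall u : R, 2 < u ->
        is_derive u 1 (fun v => v * w v) (w (u - 1))].

(* Existence and uniqueness are proved below ([buchstabP], [is_buchstab_uniq]),
   so the default value of [get] is never used. *)
Definition buchstab : R -> R := get [set w | is_buchstab w].

End analytic.

Section analytic_facts.
Variable R : realType.

Lemma cvg_euler_gamma :
  (fun n : nat => harm R n - ln n%:R) @ \oo --> euler_gamma R.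
Proof.
set g := (X in X @ \oo --> _).
suff : cvgn g by [].
suff : cvgn [sequence g n.+1]_n by move=> /cvg_ex[l gl]; apply/cvg_ex; exists l; rewrite -(cvg_shiftS g).
have lnS n : (0 < n)%N -> ln n.+1%:R - ln n%:R <= n%:R^-1 :> R.
  move=> n0; have n0' : 0 < n%:R :> R by rewrite ltr0n.
  rewrite -ln_div ?posrE ?ltr0n//.
  rewrite -(@natr1 R n) mulrDl divff ?gt_eqF// mul1r; apply: le_ln1Dx.
  by rewrite (lt_le_trans (ltrN10 R))// invr_ge0 ltW.
apply: nonincreasing_is_cvgn.
  apply/nonincreasing_seqP => n; rewrite /= /g /harm [in leLHS]big_nat_recr//= -subr_ge0.
  have n2 : 0 < n.+2%:R :> R by rewrite ltr0n.
  have n1 : 0 < n.+1%:R :> R by rewrite ltr0n.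
  have : ln (1 - n.+2%:R^-1 : R) <= - n.+2%:R^-1.
    apply: le_ln1Dx; rewrite ltrN2 invf_lt1// ltr1n //.
  have -> : 1 - n.+2%:R^-1 = n.+1%:R / n.+2%:R :> R.
    by rewrite -(@natr1 R n.+1) in n2 *; field; rewrite gt_eqF.
  rewrite ln_div ?posrE// => H.
  move: (\sum_(1 <= k < n.+2) _) (ln n.+1%:R) (ln n.+2%:R) (n.+2%:R^-1) H => S a b c; lra.
exists 0 => _ [n _ <-]; rewrite /g.
have : ln n.+1%:R <= harm R n.+1.
  have : ln n.+1%:R <= harm R n.
    elim: n => [|n IH]; first by rewrite /harm big_nil ln1.
    rewrite /harm big_nat_recr//= -/(harm R n).
    have := lnS n.+1 isT; move: IH.
    by move: (harm R n) (ln n.+1%:R) (ln n.+2%:R) (n.+1%:R^-1) => S a b c; lra.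
  move=> /le_trans; apply; rewrite /harm [leRHS]big_nat_recr//= lerDl.
  by rewrite invr_ge0.
by rewrite subr_ge0.
Qed.

Lemma is_buchstab_uniq (w w' : R -> R) :
  is_buchstab w -> is_buchstab w' -> w = w'.
Proof.
move=> [w0 w1 wc wd] [w0' w1' wc' wd'].
suff H (n : nat) u : u <= n.+2%:R -> w u = w' u.
  apply/funext => u; apply: (H (Num.truncn `|u|)).
  rewrite (le_trans (ler_norm u))// ltW// (lt_le_trans (truncnS_gt `|u|))//.
  by rewrite ler_nat.
elim: n u => [|n IH] u un.
  have [u1|u1] := ltP u 1; first by rewrite w0 ?w0'.
  by rewrite w1 ?w1' ?u1 ?un.
have [u2|u2] := leP u 2.
  by apply: IH; rewrite (le_trans u2)// ler_nat.
pose d v := v * w v - v * w' v.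
have dd x : x \in `]2, u[%R -> is_derive x 1 d ((cst 0 : R -> R) x).
  rewrite in_itv/= => /andP[x2 xu].
  have e : w (x - 1) = w' (x - 1).
    by apply: IH; move: un; rewrite -(@natr1 R n.+2); lra.
  have := @is_deriveB _ _ _ _ _ _ _ _ _ (wd _ x2) (wd' _ x2).
  by rewrite e subrr.
have dc : {within `[2, u], continuous d}.
  have sub : `[2, u] `<=` `[1, +oo[.
    by move=> x /=; rewrite !in_itv/= andbT => /andP[? _]; lra.
  have wc2 := continuous_subspaceW sub wc.
  have wc2' := continuous_subspaceW sub wc'.
  have idc : {within `[2, u], continuous (fun v : R => v)}.
    by apply: continuous_subspaceT => v; exact: cvg_id.
  move=> x; apply: cvgB; apply: cvgM; try exact: wc2; try exact: wc2';
    exact: idc.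
have [c _] := MVT_segment (ltW u2) dd dc.
rewrite mul0r /d (w1 2) ?(w1' 2) ?lexx ?ler1n// subrr subr0 => /eqP.
rewrite subr_eq0 => /eqP /mulfI; apply; rewrite gt_eqF//; lra.
Qed.


(* Construction of Buchstab's function: h u = u * omega u, extended by 1 to the
   left of 1, satisfies h u = 1 + \int_1^(u - 1) h t / t dt; the Picard iterates
   starting from 1 are stationary on every half-line `]-oo, N]. *)
Let prim (phi : R -> R) (u : R) : R :=
  parameterized_integral lebesgue_measure 0 u phi.
Let P (phi : R -> R) (u : R) : R := prim phi (Num.max u 1) - prim phi 1.

Let prim_derive (phi : R -> R) (u : R) : continuous phi -> 0 < u ->
  is_derive u 1 (prim phi) (phi u).
Proof.
move=> cphi u0.
have := @continuous_FTC1_closed R phi 0 u (u + 1) _ _ u0 (cphi u).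
case.
- by rewrite ltrDl.
- apply: continuous_compact_integrable; first exact: segment_compact.
  exact: continuous_subspaceT.
by move=> d <-; rewrite derive1E; exact: DeriveDef.
Qed.

Let P_derive (phi : R -> R) (u : R) : continuous phi -> 1 < u ->
  is_derive u 1 (P phi) (phi u).
Proof.
move=> cphi u1.
have dp := prim_derive cphi (lt_trans ltr01 u1).
have : is_derive u 1 (fun v => prim phi v - prim phi 1) (phi u).
  by rewrite -[X in is_derive _ _ _ X]subr0; exact: is_deriveB.
apply: near_eq_is_derive; near=> v; rewrite /P max_l//.
by near: v; exact: lt_le_nbhsr.
Unshelve. all: by end_near. Qed.

Let P_cont (phi : R -> R) : continuous phi -> continuous (P phi).
Proof.
move=> cphi u; apply: cvgB; last exact: cvg_cst.
apply: (@continuous_comp _ _ _ (fun u : R => Num.max u 1) (prim phi) u).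
  by apply: continuous_max; [exact: cvg_id|exact: cvg_cst].
apply: differentiable_continuous; apply/derivable1_diffP.
have m1 : 0 < Num.max u 1 by rewrite lt_max ltr01 orbT.
by have [] := prim_derive cphi m1.
Qed.

Let P_eq (phi psi : R -> R) (u : R) :
  (forall v, v <= Num.max u 1 -> phi v = psi v) -> P phi u = P psi u.
Proof.
move=> e; rewrite /P /prim /parameterized_integral.
congr (_ - _); apply: eq_Rintegral => v; rewrite inE/= in_itv/= => /andP[_ vu].
  exact: e.
by apply: e; rewrite le_max vu orbT.
Qed.

Let P_le1 (phi : R -> R) (u : R) : u <= 1 -> P phi u = 0.
Proof. by move=> u1; rewrite /P max_r// subrr. Qed.

Let quo (h : R -> R) (t : R) : R := h t / Num.max t 1.
Fixpoint buchstab_iter (k : nat) : R -> R :=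
  if k is k'.+1 then fun u => 1 + P (quo (buchstab_iter k')) (u - 1) else fun=> 1.

Let quo_cont (h : R -> R) : continuous h -> continuous (quo h).
Proof.
move=> ch u; apply: cvgM; first exact: ch.
apply: cvgV; first by rewrite gt_eqF// lt_max ltr01 orbT.
by apply: continuous_max; [exact: cvg_id|exact: cvg_cst].
Qed.

Let buchstab_iter_cont k : continuous (buchstab_iter k).
Proof.
elim: k => [|k IH] /= u; first exact: cvg_cst.
apply: cvgD; first exact: cvg_cst.
apply: (@continuous_comp _ _ _ (fun u : R => u - 1) (P (quo (buchstab_iter k))) u).
  by apply: cvgB; [exact: cvg_id|exact: cvg_cst].
exact/P_cont/quo_cont.
Qed.

Let buchstab_iterS k u : u <= k.+2%:R -> buchstab_iter k.+1 u = buchstab_iter k u.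
Proof.
elim: k u => [|k IH] u uk; first by rewrite /= P_le1 ?addr0//; lra.
change (1 + P (quo (buchstab_iter k.+1)) (u - 1) = 1 + P (quo (buchstab_iter k)) (u - 1)).
congr (1 + _); apply: P_eq => v.
rewrite le_max => vu; rewrite /quo IH//.
case/orP: vu => [vu|v1]; last by rewrite (le_trans v1)// ler1n.
by move: uk; rewrite -(@natr1 R k.+2); lra.
Qed.

Let buchstab_iter_stable k n u : (k <= n)%N -> u <= k.+2%:R -> buchstab_iter n u = buchstab_iter k u.
Proof.
move=> /subnK <- uk; elim: (n - k)%N => [//|j IH].
by rewrite addSn buchstab_iterS ?IH// (le_trans uk)// ler_nat !ltnS leq_addl.
Qed.

Let h (u : R) : R := buchstab_iter (Num.truncn `|u|) u.

Let hE k u : u <= k.+2%:R -> h u = buchstab_iter k u.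
Proof.
move=> uk; have ut : u <= (Num.truncn `|u|).+2%:R.
  rewrite (le_trans (ler_norm u))// ltW// (lt_le_trans (truncnS_gt `|u|))//.
  by rewrite ler_nat.
by case: (leqP k (Num.truncn `|u|)) => [|/ltnW] le; rewrite /h ?(buchstab_iter_stable le).
Qed.

Let h_near (u : R) : {k | \forall v \near u, h v = buchstab_iter k v & h u = buchstab_iter k u}.
Proof.
have ut : u < (Num.truncn `|u|).+2%:R.
  rewrite (le_lt_trans (ler_norm u))// (lt_le_trans (truncnS_gt `|u|))//.
  by rewrite ler_nat.
exists (Num.truncn `|u|); last by rewrite (hE (ltW ut)).
by near=> v; apply: hE; near: v; exact: lt_le_nbhsl.
Unshelve. all: by end_near. Qed.

Let h_cont : continuous h.
Proof.
move=> u; have [k hn hu] := h_near u; rewrite /continuous_at hu.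
apply: (@cvg_trans _ (buchstab_iter k @ u)); last exact: buchstab_iter_cont.
by apply: near_eq_cvg; near do apply/esym.
Unshelve. all: by end_near. Qed.

Let h_le2 u : u <= 2 -> h u = 1.
Proof. by move=> u2; rewrite (@hE 0%N). Qed.

Let h_derive (u : R) : 2 < u -> is_derive u 1 h (quo h (u - 1)).
Proof.
move=> u2.
have dP : is_derive u 1 (fun u => P (quo h) (u - 1)) (quo h (u - 1)).
  have u1 : 1 < u - 1 by lra.
  have d1 := P_derive (quo_cont h_cont) u1.
  have d2 : is_derive u 1 (fun u : R => u - 1) 1.
    by rewrite -[X in is_derive _ _ _ X]subr0; apply: is_deriveB.
  have := @is_derive1_comp _ (P (quo h)) (fun u => u - 1) _ _ _ d1 d2.
  by rewrite mulr1.
have : is_derive u 1 (fun u => 1 + P (quo h) (u - 1)) (quo h (u - 1)).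
  by rewrite -[X in is_derive _ _ _ X]add0r; apply: is_deriveD.
apply: near_eq_is_derive; near=> v.
have [k vk] : {k : nat | v <= k.+2%:R}.
  exists (Num.truncn `|v|).
  rewrite (le_trans (ler_norm v))// ltW// (lt_le_trans (truncnS_gt `|v|))//.
  by rewrite ler_nat.
rewrite (@hE k.+1 v) /=; last by rewrite (le_trans vk)// ler_nat.
congr (1 + _); apply: P_eq => t; rewrite le_max => /orP tv.
rewrite /quo (@hE k)//.
by case: tv => [tv|t1]; [lra|rewrite (le_trans t1)// ler1n].
Unshelve. all: by end_near. Qed.

Lemma is_buchstab_exists : exists w : R -> R, is_buchstab w.
Proof.
exists (fun u => if u < 1 then 0 else h u / u); split.
- by move=> u ->.
- by move=> u /andP[u1 u2]; rewrite ltNge u1/= h_le2// mul1r.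
- have : {within `[1, +oo[, continuous (quo h)}.
    exact/continuous_subspaceT/quo_cont/h_cont.
  apply: subspace_eq_continuous => u.
  rewrite inE/= in_itv/= andbT => u1.
  by rewrite /from_subspace /quo ltNge u1/= max_l.
- move=> u u2.
  have -> : (if u - 1 < 1 then 0 else h (u - 1) / (u - 1)) = quo h (u - 1).
    by rewrite ltNge (_ : 1 <= u - 1) /quo ?max_l//; lra.
  have := h_derive u2; apply: near_eq_is_derive; near=> v.
  have v2 : 2 < v by near: v; exact: lt_nbhsr.
  rewrite ltNge (_ : 1 <= v) /=; last by lra.
  by rewrite mulrC divfK// gt_eqF//; lra.
Unshelve. all: by end_near. Qed.

Lemma buchstabP : is_buchstab (@buchstab R).
Proof. exact: getPex is_buchstab_exists. Qed.

End analytic_facts.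

(* Main.v *)
(* Writing q = #|F|, sieving by one monic irreducible at a time shows that the
   proportions r(n, m) are the partial sums of the coefficients p_j of the
   polynomial P(z) = prod_(k <= m) (1 - (z / q) ^ k) ^ I_k, and lambda(m) = P(1).
   The logarithmic derivative of P gives n p_n = - sum_j t_j p_(n - j), and
   r(n, m) = 0 for 1 <= n <= m forces t_j = 1 for j <= m (Gauss's count of the
   irreducibles), whereas 0 <= t_j <= 2 q ^ (- j / 2) for j > m. So r(., m)
   satisfies, up to an exponentially small error, the discrete analogue
     (n + 1) (r(n + 1) - r(n)) = r(n - m) - r(n)
   of the equation u w'(u) = w(u - 1) - w(u) of Buchstab's function w.

   The second estimate is the Taylor expansion of the logarithms in ln lambda(m),
   truncated so as to involve exactly the pairs k j <= m, which produce H_m.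

   For the first one, let E(n) = r(n, m) - lambda(m) e ^ gamma w(n / m).
   - Induction on n gives |E(n)| <= A e ^ u / (m ^ 2 u), enough for bounded u.
   - With m = 16 ^ k and u = k this, together with Rankin's bound for
     r(n, m) - lambda(m) = - sum_(j > n) p_j, gives lim w = e ^ (- gamma).
   - For m ^ 3 <= e ^ (u / 5) both r - lambda and w - e ^ (- gamma) are small.
   - In between, the recursion contracts |E(n + 1) - E(n)| by a factor < 3 / 4
     relative to the weight g(u) = (u / e) ^ (- u), because g(u - s) is at
     most u ^ s g(u), so that the mean of g over [u - 1, u] is much less than
     u g(u). Summing the differences backwards from the previous range
     bounds E(n). *)

Require Import Defs.
From HB Require Import structures.
From mathcomp Require Import all_boot all_order all_algebra.
From mathcomp Require Import all_classical all_reals all_analysis.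
From mathcomp Require Import lra ring.
Import Order.TTheory GRing.Theory Num.Theory.
Import numFieldNormedType.Exports.

Set Implicit Arguments.
Unset Strict Implicit.
Unset Printing Implicit Defensive.

Local Open Scope ring_scope.

(** * Sieving by monic irreducible polynomials *)

Section sieve.
Variable F : finFieldType.
Implicit Types (p d P : {poly F}) (s : seq {poly F}).

Definition monic_irred P := P \is monic /\ irreducible_poly P.

Lemma dvdp_monic_irred p : (1 < size p)%N ->
  exists P, [/\ monic_irred P, P %| p & (size P <= size p)%N].
Proof.
elim: {p}(size p) {-2}p (leqnn (size p)) => [|k IH] p; first by case: (size p).
move=> pk p1; have p0 : p != 0 by rewrite -size_poly_gt0 (ltn_trans _ p1).
have [/irreducibleP pirr|pirr] := boolP (irreducibleb p).
  have lp : (lead_coef p)^-1 != 0 by rewrite invr_eq0 lead_coef_eq0.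
  exists ((lead_coef p)^-1 *: p); split.
  - split; first by rewrite monicE lead_coefZ mulVf ?lead_coef_eq0.
    split; first by rewrite size_scale.
    move=> g g1; rewrite (dvdpZr _ _ lp) => /(pirr.2 _ g1) gp.
    by apply: eqp_trans gp _; rewrite eqp_sym eqp_scale.
  - by rewrite dvdpZl.
  - by rewrite size_scale.
move: pirr; rewrite /irreducibleb p1/= negb_forall => /existsP[g].
rewrite negb_imply -ltnNge -Pdiv.Idomain.dvdpE => /andP[gp g1].
have gs : (size (g : {poly F}) < size p)%N.
  by rewrite (leq_ltn_trans (size_npoly g))// prednK// (ltn_trans _ p1).
have [P [Pi Pg Ps]] := IH _ (leq_trans gs pk) g1.
exists P; split => //; first exact: dvdp_trans gp.
exact: leq_trans (ltnW gs).
Qed.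

Lemma monic_irred_dvdM P Q p : monic_irred P -> monic_irred Q -> P != Q ->
  (P %| Q * p) = (P %| p).
Proof.
move=> [Pm Pi] [Qm Qi] PQ; apply: Gauss_dvdpr.
rewrite irreducible_poly_coprime//; apply: contra PQ => PdQ.
rewrite -eqp_monic//; apply: Qi.2 => //.
by rewrite gtn_eqF// (leq_trans _ Pi.1).
Qed.

Definition sieved s n : nat :=
  #|[set p in monics F n | all (fun P => ~~ (P %| (p : {poly F}))) s]%SET|.

Lemma sieved_nil n : sieved [::] n = (#|F| ^ n)%N.
Proof.
by rewrite /sieved -card_monics; apply: eq_card => p; rewrite !inE andbT.
Qed.

Lemma sieved_cons P s n : monic_irred P -> {in s, forall Q, monic_irred Q} ->
    P \notin s ->
  sieved s n =
  (sieved (P :: s) n +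
   if (size P).-1 <= n then sieved s (n - (size P).-1) else 0)%N.
Proof.
move=> Pmi smi Ps; have [Pm Pi] := Pmi; set e := (size P).-1.
have Psz : size P = e.+1 by rewrite prednK// (ltn_trans _ Pi.1).
rewrite {1}/sieved -(cardsID [set p : {poly_n.+1 F} | P %| (p : {poly F})]%SET) addnC.
congr addn.
  apply: eq_card => p; rewrite !inE/=; case: (P %| _); rewrite ?andbF//=.
case: leqP => en; last first.
  apply/eqP; rewrite cards_eq0; apply/eqP/setP => p; rewrite !inE.
  apply/negP => /andP[/andP[/andP[pm /eqP ps] _] Pp].
  have := dvdp_leq (monic_neq0 pm) Pp; rewrite ps Psz ltnS leqNgt.
  by rewrite en.
pose f (g : {poly_(n - e).+1 F}) : {poly_n.+1 F} := npolyp n.+1 (P * (g : {poly F})).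
have fE (g : {poly_(n - e).+1 F}) : (f g : {poly F}) = P * (g : {poly F}).
  apply: npolypK.
  apply: (leq_trans (size_polyMleq _ _)); rewrite Psz addSn/=.
  by rewrite (leq_trans (leq_add (leqnn e) (size_npoly g)))// addnS ltnS subnKC.
have fI : injective f.
  move=> g h /(congr1 (fun x : {poly_n.+1 F} => (x : {poly F}))).
  by rewrite !fE => /(mulfI (monic_neq0 Pm))/val_inj.
rewrite /sieved -(card_imset _ fI); apply: eq_card => p; apply/idP/imsetP.
  rewrite !inE => /andP[/andP[/andP[pm /eqP ps] pall] /dvdpP[g pE]].
  have gm : g \is monic by move: pm; rewrite pE monicMr.
  have gs : size g = (n - e).+1.
    move: ps; rewrite pE size_proper_mul; last first.
      by rewrite (monicP gm) (monicP Pm) mulr1 oner_eq0.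
    by rewrite Psz addnS/= => gs; rewrite -subSn// -gs addnK.
  have gs' : (size g <= (n - e).+1)%N by rewrite gs.
  exists (npolyp (n - e).+1 g); last first.
    by apply: val_inj => /=; rewrite fE npolypK// pE mulrC.
  rewrite !inE npolypK// gm gs eqxx/=.
  apply/allP => Q Qs; have := allP pall Q Qs.
  rewrite pE mulrC monic_irred_dvdM//; first exact: smi.
  by apply: contraNneq Ps => <-.
move=> [g]; rewrite !inE => /andP[/andP[gm /eqP gs] gall] ->.
rewrite fE monicMl// gm size_proper_mul; last first.
  by rewrite (monicP gm) (monicP Pm) mulr1 oner_eq0.
rewrite Psz gs addnS/= addSn subnKC// eqxx/= dvdp_mulr ?dvdpp// andbT.
apply/allP => Q Qs; rewrite monic_irred_dvdM//; first exact: (allP gall).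
- exact: smi.
- by apply: contraNneq Ps => <-.
Qed.

Definition irreds k : {set {poly_k.+1 F}} :=
  [set p in monics F k | irreducibleb (p : {poly F})]%SET.

Definition irreds_seq k : seq {poly F} :=
  map (fun p : {poly_k.+1 F} => p : {poly F}) (enum (irreds k)).

Definition irreds_upto m : seq {poly F} :=
  flatten [seq irreds_seq k | k <- index_iota 1 m.+1].

Lemma irreds_uptoP m P :
  reflect (monic_irred P /\ (size P <= m.+1)%N) (P \in irreds_upto m).
Proof.
apply: (iffP flattenP) => [[_ /mapP[k km ->] /mapP[p]]|[[Pm Pi] Psz]].
  rewrite mem_enum !inE => /andP[/andP[pm /eqP ps] /irreducibleP pi] ->.
  by split => //; rewrite ps; move: km; rewrite mem_index_iota => /andP[].
have P1 := Pi.1; exists (irreds_seq (size P).-1).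
  apply/mapP; exists (size P).-1 => //; rewrite mem_index_iota.
  by case: (size P) P1 Psz => //= k; rewrite ltnS => -> /=.
have Psz' : (size P <= (size P).-1.+1)%N by rewrite prednK// (ltn_trans _ P1).
apply/mapP; exists (npolyp (size P).-1.+1 P); last by rewrite npolypK.
rewrite mem_enum !inE npolypK// Pm/= prednK ?eqxx ?(ltn_trans _ P1)//=.
exact/irreducibleP.
Qed.

Lemma irreds_upto_uniq m : uniq (irreds_upto m).
Proof.
have U k : uniq (irreds_seq k).
  by rewrite /irreds_seq map_inj_uniq ?enum_uniq//; exact: val_inj.
elim: m => [|m IH] //; rewrite /irreds_upto /index_iota subn1.
rewrite -[(m.+2).-1]addn1 iotaD map_cat flatten_cat cat_uniq.
move: IH; rewrite {1}/irreds_upto /index_iota subn1/= => ->.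
rewrite cats0 U andbT/=; apply/hasPn => P; rewrite add1n => /mapP[p].
rewrite mem_enum !inE => /andP[/andP[pm /eqP ps] _] ->.
apply/negP => /flattenP[_ /mapP[k km ->] /mapP[g]].
rewrite mem_enum !inE => /andP[/andP[gm /eqP gs] _] pg.
move: ps; rewrite pg gs => -[kE]; move: km.
by rewrite mem_iota kE add1n ltnn andbF.
Qed.

Lemma card_irreds k : #|irreds k| = num_irr F k. Proof. by []. Qed.

Lemma roughE m p : rough m p <-> all (fun P => ~~ (P %| p)) (irreds_upto m).
Proof.
split=> [pr|/allP pall d dp d1].
  apply/allP => P /irreds_uptoP[[Pm Pi] Psz]; apply/negP => Pp.
  by have := pr _ Pp Pi.1; rewrite ltnNge Psz.
rewrite ltnNge; apply/negP => dm.
have [P [Pi Pd Ps]] := dvdp_monic_irred d1.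
have /pall/negP : P \in irreds_upto m.
  by apply/irreds_uptoP; split => //; exact: leq_trans dm.
by apply; exact: dvdp_trans dp.
Qed.

Lemma card_rough n m :
  #|[set p in monics F n | `[< rough m (p : {poly F}) >]]%SET| =
  sieved (irreds_upto m) n.
Proof.
apply: eq_card => p; rewrite !inE; congr (_ && _).
by apply/asboolP/idP => /roughE.
Qed.

Lemma sieved_small m n : (0 < n <= m)%N -> sieved (irreds_upto m) n = 0%N.
Proof.
move=> /andP[n0 nm]; apply/eqP; rewrite cards_eq0; apply/eqP/setP => p.
rewrite !inE; apply/negP => /andP[/andP[pm /eqP ps] /roughE pr].
by have := pr _ (dvdpp _); rewrite ps => /(_ n0); rewrite ltnS ltnNge nm.
Qed.

End sieve.

(** * The sieve polynomial *)

Section sieve_polynomial.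
Variables (F : finFieldType) (R : realType).
Notation q := (#|F|%:R : R).

Lemma q_ge2 : 2 <= q.
Proof. by rewrite ler_nat card_finNzRing_gt1. Qed.

Lemma q_gt0 : 0 < q.
Proof. by rewrite (lt_le_trans _ q_ge2). Qed.

Let q_neq0 : q != 0. Proof. by rewrite gt_eqF ?q_gt0. Qed.

Definition sieve_factor (k : nat) : {poly R} := 1 - q ^- k *: 'X^k.

Definition sieve_poly (m : nat) : {poly R} :=
  \prod_(1 <= k < m.+1) sieve_factor k ^+ num_irr F k.

Lemma sievedE (s : seq {poly F}) n :
  uniq s -> {in s, forall P, monic_irred P} ->
  (sieved s n)%:R / q ^+ n =
  \sum_(j < n.+1) (\prod_(P <- s) sieve_factor (size P).-1)`_j.
Proof.
elim: s n => [|P s IH] n.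
  rewrite sieved_nil natrX divff ?expf_neq0// big_nil => _ _.
  rewrite big_ord_recl coef1 eqxx big1 ?addr0// => i _.
  by rewrite coef1.
rewrite [uniq _]/= => /andP[Ps us] smi.
have Pmi : monic_irred P by apply: smi; rewrite mem_head.
have smi' : {in s, forall Q, monic_irred Q}.
  by move=> Q Qs; apply: smi; rewrite inE Qs orbT.
have := sieved_cons n Pmi smi' Ps; set e := (size P).-1 => /(congr1 (fun k => k%:R : R)).
rewrite natrD => sE.
have -> : (sieved (P :: s) n)%:R = (sieved s n)%:R -
  (if (e <= n)%N then sieved s (n - e) else 0%N)%:R :> R by rewrite sE addrK.
rewrite mulrBl IH// big_cons -/e.
set Q := \prod_(_ <- _) _.
have coefE j : (sieve_factor e * Q)`_j = Q`_j - q ^- e * (if (j < e)%N then 0 else Q`_(j - e)).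
  by rewrite mulrBl mul1r -scalerAl coefB coefZ coefXnM.
under [RHS]eq_bigr do rewrite coefE.
rewrite [RHS]big_split/= sumrN; congr (_ - _); rewrite -mulr_sumr.
case: leqP => en; last first.
  rewrite mul0r big1 ?mulr0// => -[j jn] _ /=.
  by rewrite (leq_trans jn).
have -> : (sieved s (n - e))%:R / q ^+ n =
    q ^- e * ((sieved s (n - e))%:R / q ^+ (n - e)).
  have -> : q ^+ n = q ^+ (n - e) * q ^+ e by rewrite -exprD subnK.
  by field; rewrite !expf_neq0.
rewrite IH// -/Q; congr (_ * _).
rewrite -(big_mkord xpredT (fun j => if (j < e)%N then 0 else Q`_(j - e))).
rewrite (@big_cat_nat _ _ _ e)//=; last exact: leq_trans en _.
rewrite [X in _ = X + _]big_nat_cond [X in _ = X + _]big1 ?add0r; last first.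
  by move=> j /andP[/andP[_ je] _]; rewrite je.
rewrite (@big_addn _ _ _ 0) subSn// big_mkord.
by apply: eq_bigr => j _; rewrite ltnNge leq_addl/= addnK.
Qed.

Lemma prod_irreds m :
  \prod_(P <- irreds_upto F m) sieve_factor (size P).-1 = sieve_poly m.
Proof.
rewrite /irreds_upto big_flatten big_map; apply: eq_bigr => k _.
rewrite /irreds_seq big_map big_enum/= (eq_bigr (fun=> sieve_factor k)).
  by rewrite prodr_const card_irreds.
by move=> p; rewrite !inE => /andP[/andP[_ /eqP->]].
Qed.

Lemma rough_propE n m : rough_prop F R n m = \sum_(j < n.+1) (sieve_poly m)`_j.
Proof.
rewrite /rough_prop card_rough card_monics natrX sievedE ?prod_irreds//.
  exact: irreds_upto_uniq.
by move=> P /irreds_uptoP[].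
Qed.

Lemma lambdaE m : lambda F R m = (sieve_poly m).[1].
Proof.
rewrite /lambda /sieve_poly horner_prod; apply: eq_bigr => k _.
by rewrite horner_exp !hornerE expr1n mulr1.
Qed.

Lemma rough_prop_ge0 n m : 0 <= rough_prop F R n m.
Proof. by rewrite divr_ge0. Qed.

Lemma rough_prop_le1 n m : rough_prop F R n m <= 1.
Proof.
rewrite ler_pdivrMr ?mul1r ?ler_nat; last by rewrite card_monics natrX exprn_gt0 ?q_gt0.
by apply/subset_leq_card/fintype.subsetP => p; rewrite inE => /andP[].
Qed.

Lemma rough_prop_small n m : (0 < n <= m)%N -> rough_prop F R n m = 0.
Proof. by move=> nm; rewrite /rough_prop card_rough sieved_small// mul0r. Qed.

Lemma sieve_poly0 m : (sieve_poly m)`_0 = 1.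
Proof.
rewrite -horner_coef0 /sieve_poly horner_prod big_nat_cond big1// => k /andP[/andP[k0 _] _].
rewrite horner_exp !hornerE expr0n.
by rewrite eqn0Ngt k0/= mulr0 subr0 expr1n.
Qed.

Lemma rough_prop0 m : rough_prop F R 0 m = 1.
Proof. by rewrite rough_propE big_ord_recl big_ord0 addr0 sieve_poly0. Qed.

Lemma rough_propS n m :
  rough_prop F R n.+1 m = rough_prop F R n m + (sieve_poly m)`_n.+1.
Proof. by rewrite !rough_propE big_ord_recr. Qed.

(* [- log_deriv_coef m n] is the coefficient of [z ^ n] in [z P'(z) / P(z)]
   for [P = sieve_poly m]. *)
Definition log_deriv_coef (m n : nat) : R :=
  (\sum_(1 <= k < m.+1 | (k %| n)%N) (k * num_irr F k)%:R) / q ^+ n.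

Let T1 (N k : nat) : {poly R} :=
  k%:R *: \sum_(1 <= j < N.+1) (q ^- k *: 'X^k) ^+ j.

Let D N (f T : {poly R}) := 'X^(N.+1) %| 'X * f^`() + f * T.

Let D_one N : D N 1 0.
Proof. by rewrite /D derivC !mulr0 addr0 dvdp0. Qed.

Let D_mul N f1 S1 f2 S2 : D N f1 S1 -> D N f2 S2 -> D N (f1 * f2) (S1 + S2).
Proof.
move=> d1 d2; rewrite /D derivM.
have -> : 'X * (f1^`() * f2 + f1 * f2^`()) + f1 * f2 * (S1 + S2) =
  ('X * f1^`() + f1 * S1) * f2 + f1 * ('X * f2^`() + f2 * S2) by ring.
by apply: dvdp_add; [exact: dvdp_mulr|exact: dvdp_mull].
Qed.

Let D_factor N k : (0 < k)%N -> D N (sieve_factor k) (T1 N k).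
Proof.
move=> k0; rewrite /D /sieve_factor /T1; set y := q ^- k *: 'X^k.
have -> : 'X * (1 - y)^`() = - (k%:R *: y).
  rewrite derivB derivC sub0r mulrN; congr (- _).
  rewrite /y derivZ derivXn -scalerAr mulrnAr -exprS prednK//.
  by rewrite scaler_nat scalerMnr.
have -> : (1 - y) * (k%:R *: \sum_(1 <= j < N.+1) y ^+ j) = k%:R *: (y - y ^+ N.+1).
  rewrite -scalerAr; congr (_ *: _); elim: N => [|N IH].
    by rewrite big_nil mulr0 expr1 subrr.
  by rewrite big_nat_recr//= mulrDr IH !exprS; ring.
rewrite scalerBr addrA addNr sub0r dvdpNr dvdpZr ?pnatr_eq0 -?lt0n//.
rewrite /y exprZn dvdpZr ?expf_neq0 ?invr_eq0 ?expf_neq0//.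
by rewrite -exprM dvdp_exp2l// leq_pmull.
Qed.

Let D_poly N m : D N (sieve_poly m)
  (\sum_(1 <= k < m.+1) T1 N k *+ num_irr F k).
Proof.
rewrite /sieve_poly big_nat_cond [X in D _ _ X]big_nat_cond.
apply: (big_ind2 (D N)); [exact: D_one|by move=> *; exact: D_mul|].
move=> k /andP[/andP[k0 _] _]; elim: (num_irr F k) => [|I IH].
  by rewrite expr0 mulr0n; exact: D_one.
by rewrite exprS mulrS; apply: D_mul => //; exact: D_factor.
Qed.

Let T1_coef N k n : (0 < k)%N -> (0 < n <= N)%N ->
  (T1 N k)`_n = if (k %| n)%N then k%:R * q ^- n else 0.
Proof.
move=> k0 /andP[n0 nN]; rewrite coefZ coef_sum.
have E j : ((q ^- k *: 'X^k) ^+ j)`_n = if n == (k * j)%N then q ^- n else 0 :> R.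
  rewrite exprZn -exprM coefZ coefXn; case: eqP => [->|_]; last by rewrite mulr0.
  by rewrite mulr1 exprVn -exprM.
under eq_bigr do rewrite E.
case: ifPn => [/dvdnP[j nE]|kn]; last first.
  rewrite big1 ?mulr0// => j _; case: eqP => // nE; case/negP: kn.
  by rewrite nE dvdn_mulr.
congr (_ * _); have j0 : (0 < j)%N by move: n0; rewrite nE; case: (j).
have jN : (j <= N)%N by rewrite (leq_trans _ nN)// nE leq_pmulr.
rewrite (bigD1_seq j) ?iota_uniq ?mem_index_iota ?j0//=.
rewrite {1}nE mulnC eqxx big1 ?addr0// => i ij.
case: eqP => // /eqP; rewrite nE mulnC eqn_pmul2l// => ji.
by rewrite (eqP ji) eqxx in ij.
Qed.

Let T_coef N m n : (0 < n <= N)%N ->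
  (\sum_(1 <= k < m.+1) T1 N k *+ num_irr F k)`_n = log_deriv_coef m n.
Proof.
move=> nN; rewrite coef_sum /log_deriv_coef mulr_suml [RHS]big_mkcond/=.
apply: eq_big_nat => k /andP[k0 _]; rewrite coefMn T1_coef//.
by case: ifP => _; [rewrite natrM -mulr_natr; ring|rewrite mul0rn].
Qed.

Lemma sieve_poly_rec m n :
  n.+1%:R * (sieve_poly m)`_n.+1 =
  - \sum_(1 <= j < n.+2) log_deriv_coef m j * (sieve_poly m)`_(n.+1 - j).
Proof.
have /dvdpP[g /(congr1 (fun f : {poly R} => f`_n.+1))] := D_poly n.+1 m.
rewrite coefMXn ltnSn coefD coefXM/= coef_deriv => /eqP.
rewrite addr_eq0 mulr_natl => /eqP ->; congr (- _).
rewrite coefMr -(big_mkord xpredT (fun j => (sieve_poly m)`_(n.+1 - j) * _`_j)).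
rewrite big_nat_recl// [X in _ * X](_ : _ = 0) ?mulr0 ?add0r; last first.
  rewrite coef_sum big_nat_cond big1// => k /andP[/andP[k0 _] _].
  rewrite coefMn coefZ coef_sum big_nat_cond big1 ?mulr0 ?mul0rn// => j /andP[/andP[j0 _] _].
  rewrite exprZn -exprM coefZ coefXn.
  by rewrite eq_sym muln_eq0 !eqn0Ngt k0 j0 mulr0.
rewrite [RHS]big_add1/=; apply: eq_big_nat => j /andP[_ jn].
by rewrite T_coef//= mulrC.
Qed.

Lemma sieve_poly_coef m n : (0 < m)%N -> (n <= m)%N ->
  (sieve_poly m)`_n = (n == 0%N)%:R - (n == 1%N)%:R.
Proof.
move=> m0; case: n => [|n] nm; first by rewrite sieve_poly0 subr0.
have := rough_propS n m; rewrite rough_prop_small//.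
case: n nm => [|n] nm.
  by rewrite rough_prop0 sub0r => /eqP; rewrite eq_sym addrC addr_eq0 => /eqP.
by rewrite rough_prop_small ?(ltnW nm)// add0r subrr.
Qed.

Lemma log_deriv_coef_small m n : (0 < n <= m)%N -> log_deriv_coef m n = 1.
Proof.
case: n => // n /=; elim: n => [|n IH] nm.
  have := sieve_poly_rec m 0; rewrite big_nat1 subnn sieve_poly_coef//.
  by rewrite sieve_poly0 sub0r mulr1 mul1r => /oppr_inj.
have m0 : (0 < m)%N by exact: leq_trans nm.
have := sieve_poly_rec m n.+1; rewrite sieve_poly_coef// subrr mulr0 => /esym /eqP.
rewrite oppr_eq0 big_nat_recr//= subnn big_nat_recr//= subSnn sieve_poly0.
rewrite sieve_poly_coef// sub0r mulr1 IH ?(ltnW nm)//.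
rewrite big_nat_cond big1 ?add0r.
  by rewrite addrC mul1r subr_eq0 => /eqP.
move=> j /andP[/andP[j0 jn] _]; rewrite sieve_poly_coef//; last first.
  by rewrite (leq_trans (leq_subr _ _)).
have j1 : (1 < n.+2 - j)%N by rewrite ltn_subRL addn1 !ltnS.
by rewrite !gtn_eqF ?subrr ?mulr0// (ltn_trans _ j1).
Qed.

Lemma sum_dvd_num_irr n : (0 < n)%N ->
  \sum_(1 <= k < n.+1 | (k %| n)%N) (k * num_irr F k)%:R = q ^+ n.
Proof.
move=> n0; have := @log_deriv_coef_small n n; rewrite n0 leqnn => /(_ isT).
by move/divr1_eq.
Qed.

Lemma num_irr_le k : k%:R * (num_irr F k)%:R <= q ^+ k.
Proof.
case: k => [|k]; first by rewrite mul0r.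
rewrite -sum_dvd_num_irr// big_mkcond big_nat_recr//= dvdnn natrM.
by rewrite lerDr sumr_ge0// => i _; case: ifP.
Qed.

Lemma log_deriv_coef_ge0 m n : 0 <= log_deriv_coef m n.
Proof.
by rewrite divr_ge0// ?exprn_ge0// sumr_ge0.
Qed.

Lemma sum_expr_le J : \sum_(1 <= k < J.+1) q ^+ k <= 2 * q ^+ J.
Proof.
elim: J => [|J IH]; first by rewrite big_nil mulr_ge0.
rewrite big_nat_recr//= (le_trans (lerD IH (lexx _)))//.
rewrite [in leLHS]mulrC.
have := q_ge2; have : 0 <= q ^+ J by rewrite exprn_ge0.
by rewrite exprS; nra.
Qed.

Lemma log_deriv_coef_le m n : (m < n)%N ->
  log_deriv_coef m n <= 2 * q ^- (uphalf n).
Proof.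
move=> mn; have n0 : (0 < n)%N by exact: leq_trans mn.
rewrite ler_pdivrMr ?exprn_gt0 ?q_gt0//.
have -> : 2 * q ^- uphalf n * q ^+ n = 2 * q ^+ n./2.
  rewrite -{2}(odd_double_half n) -addnn addnA -uphalf_half exprD.
  by rewrite -mulrA mulKf// expf_neq0.
apply: le_trans (sum_expr_le n./2).
rewrite [leLHS]big_mkcond/=.
have [hm|/ltnW hm] := leqP n./2 m.
  rewrite (@big_cat_nat _ _ _ n./2.+1)//= [X in _ + X]big_nat_cond [X in _ + X]big1 ?addr0.
    apply: ler_sum_nat => k /andP[k0 _]; case: ifP => _.
      by rewrite natrM num_irr_le.
    by rewrite exprn_ge0.
  move=> k /andP[/andP[k1 k2] _]; case: ifP => // /dvdnP[j nE]; exfalso.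
  case: j nE => [|[|j]] nE; first by move: n0; rewrite nE.
    by move: mn; rewrite nE mul1n ltnNge -ltnS k2.
  move: k1; rewrite ltnNge geq_half_double nE -mul2n leq_mul2r ?orbT//.
rewrite (@big_cat_nat _ _ _ m.+1 _ n./2.+1)//=.
rewrite -[leLHS]addr0 lerD//.
  apply: ler_sum_nat => k /andP[k0 _]; case: ifP => _.
    by rewrite natrM num_irr_le.
  by rewrite exprn_ge0.
by rewrite sumr_ge0// => k _; rewrite exprn_ge0.
Qed.

End sieve_polynomial.

(** * The constant lambda *)

Section log_taylor.
Variable R : realType.
Local Open Scope classical_set_scope.

Lemma derive_ge0_le (f df : R -> R) (a b : R) : a <= b ->
  (forall x, a < x < b -> is_derive x 1 f (df x)) ->
  {within `[a, b], continuous f} ->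
  (forall x, a < x < b -> 0 <= df x) -> f a <= f b.
Proof.
rewrite le_eqVlt => /predU1P[->//|ab] fd fc df0.
have fd' x : x \in `]a, b[%R -> is_derive x 1 f (df x).
  by rewrite in_itv/=; exact: fd.
have [c] := MVT ab fd' fc; rewrite in_itv/= => cab /eqP.
rewrite subr_eq => /eqP ->; rewrite lerDr mulr_ge0 ?df0// subr_ge0 ltW//.
Qed.

Lemma is_derive_within_continuous (f df : R -> R) (a b : R) :
  (forall x, a <= x <= b -> is_derive x 1 f (df x)) ->
  {within `[a, b], continuous f}.
Proof.
move=> fd; apply: derivable_within_continuous => x.
by rewrite in_itv/= => /fd[].
Qed.

Lemma is_derive_ge0_le (f df : R -> R) (a b : R) : a <= b ->
  (forall x, a <= x <= b -> is_derive x 1 f (df x)) ->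
  (forall x, a <= x <= b -> 0 <= df x) -> f a <= f b.
Proof.
move=> ab fd df0; have fc := is_derive_within_continuous fd.
apply: (derive_ge0_le ab _ fc) => [x /andP[ax xb]|x /andP[ax xb]].
  by apply: fd; rewrite !ltW.
by apply: df0; rewrite !ltW.
Qed.

Let taylor (J : nat) (y : R) : R := \sum_(1 <= j < J.+1) y ^+ j / j%:R.

Let taylor_derive J (y : R) : is_derive y 1 (taylor J) (\sum_(j < J) y ^+ j).
Proof.
elim: J => [|J IH].
  rewrite big_ord0 (_ : taylor 0 = cst 0); first exact: is_derive_cst.
  by apply/funext => z; rewrite /taylor big_nil.
rewrite big_ord_recr/=.
have -> : taylor J.+1 = taylor J + J.+1%:R^-1 \*: (id : R -> R) ^+ J.+1.
  apply/funext => z; rewrite /taylor big_nat_recr//= mulrC.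
  by rewrite exprfctE.
apply: is_deriveD; apply: is_derive_eq.
rewrite -[_ *: _]/(_ * _) -[_%:A]/(_ * _) mulr1.
by rewrite mulKf// pnatr_eq0.
Qed.

Let taylor0 J : taylor J 0 = 0.
Proof.
by rewrite /taylor big_nat_cond big1// => -[|j]//; rewrite expr0n mul0r.
Qed.

Lemma ln_taylor_bounds (J : nat) (x : R) : 0 <= x <= 2^-1 ->
  0 <= - ln (1 - x) - \sum_(1 <= j < J.+1) x ^+ j / j%:R <=
    2 * (x ^+ J.+1 / J.+1%:R).
Proof.
move=> /andP[x0 x2].
pose f : R -> R := - (@ln R \o (fun z => 1 - z)) - taylor J.
have fd (y : R) : y < 1 -> is_derive y 1 f (y ^+ J / (1 - y)).
  move=> y1; have y10 : 0 < 1 - y by lra.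
  have d1 : is_derive y 1 (fun z : R => 1 - z) (-1).
    by rewrite -[X in is_derive _ _ _ X]add0r; apply: is_deriveD.
  have d2 := @is_derive1_comp _ (@ln R) (fun z => 1 - z) _ _ _ (is_derive1_ln y10) d1.
  have -> : y ^+ J / (1 - y) = - ((1 - y)^-1 * -1) - \sum_(j < J) y ^+ j.
    have : (1 - y) * \sum_(j < J) y ^+ j = 1 - y ^+ J.
      by rewrite -opprB mulNr -subrX1 opprB.
    move: (\sum_(j < J) y ^+ j) (y ^+ J) => S Y SY.
    have -> : Y = 1 - (1 - y) * S by rewrite SY; ring.
    by field; rewrite gt_eqF.
  by have d3 := taylor_derive J y; apply: is_deriveB.
have fx : f x = - ln (1 - x) - \sum_(1 <= j < J.+1) x ^+ j / j%:R by [].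
have f0 : f 0 = 0.
  by rewrite /f /= (_ : (_ - _) 0 = - ln (1 - 0) - taylor J 0)// taylor0 !subr0 ln1 oppr0.
rewrite -fx; apply/andP; split.
  rewrite -f0; apply: (@is_derive_ge0_le _ (fun y => y ^+ J / (1 - y))) => //.
    by move=> y /andP[y0 yx]; apply: fd; lra.
  by move=> y /andP[y0 yx]; rewrite divr_ge0 ?exprn_ge0//; lra.
pose g : R -> R := (2 / J.+1%:R) \*: (id : R -> R) ^+ J.+1 - f.
have gE z : g z = 2 * (z ^+ J.+1 / J.+1%:R) - f z.
  have -> : g z = 2 / J.+1%:R * ((id ^+ J.+1 : R -> R) z) - f z by [].
  by rewrite exprfctE mulrAC mulrA.
have : g 0 <= g x.
  apply: (@is_derive_ge0_le g (fun y => 2 * y ^+ J - y ^+ J / (1 - y)) 0 x x0).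
    move=> y /andP[y0 yx]; have y1 : y < 1 by lra.
    have fdy := fd y y1.
    have pd : is_derive y 1 ((2 / J.+1%:R) \*: (id : R -> R) ^+ J.+1) (2 * y ^+ J).
      apply: is_derive_eq.
      rewrite -[_ *: _]/(_ * _) -[_%:A]/(_ * _) mulr1.
      by rewrite mulrA divfK// pnatr_eq0.
    exact: is_deriveB.
  move=> y /andP[y0 yx]; rewrite subr_ge0 ler_pdivrMr; last by lra.
  by have := exprn_ge0 J y0; move: (y ^+ J) => Y Y0; nra.
by rewrite !gE f0 expr0n/= mul0r mulr0 subr0 subr_ge0.
Qed.

End log_taylor.

Section lambda_estimates.
Variables (F : finFieldType) (R : realType).
Notation q := (#|F|%:R : R).

Let q_neq0 : q != 0. Proof. by rewrite gt_eqF ?q_gt0. Qed.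

Lemma invq_le (k : nat) : (0 < k)%N -> 0 <= q ^- k <= 2^-1.
Proof.
move=> k0; rewrite invr_ge0 exprn_ge0//= lef_pV2 ?posrE ?exprn_gt0 ?q_gt0//.
rewrite (le_trans (q_ge2 F R))// -{1}[q]expr1 ler_eXn2l// (lt_le_trans _ (q_ge2 F R))//.
by rewrite ltr1n.
Qed.

Lemma sum_dvdn_reindex (m k : nat) (f : nat -> R) : (0 < k)%N ->
  \sum_(1 <= N < m.+1 | (k %| N)%N) f N =
  \sum_(1 <= j < (m %/ k).+1) f (k * j)%N.
Proof.
move=> k0; elim: m => [|m IH]; first by rewrite div0n !big_nil.
rewrite big_mkcond big_nat_recr//= -big_mkcond/= IH divnS//.
case: (boolP (k %| m.+1)%N) => kd /=; last by rewrite addr0.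
rewrite add1n [RHS]big_nat_recr//=; congr (_ + f _).
by have := divnK kd; rewrite divnS// kd add1n mulnC => ->.
Qed.

Lemma harm_sum m : harm R m =
  \sum_(1 <= k < m.+1) (num_irr F k)%:R *
    \sum_(1 <= j < (m %/ k).+1) (q ^- k) ^+ j / j%:R.
Proof.
rewrite /harm.
transitivity (\sum_(1 <= N < m.+1) N%:R^-1 * log_deriv_coef F R m N).
  by apply: eq_big_nat => N Nm; rewrite log_deriv_coef_small ?mulr1.
transitivity (\sum_(1 <= N < m.+1) \sum_(1 <= k < m.+1)
   if (k %| N)%N then (num_irr F k)%:R * ((k%:R / N%:R) * q ^- N) else 0).
  apply: eq_bigr => N _; rewrite /log_deriv_coef big_mkcond mulr_suml mulr_sumr.
  apply: eq_bigr => k _; case: ifP => _; last by rewrite mul0r mulr0.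
  by rewrite natrM; ring.
rewrite exchange_big/=; apply: eq_big_nat => k /andP[k0 _].
rewrite -big_mkcond/= -mulr_sumr; congr (_ * _).
rewrite (sum_dvdn_reindex _ (fun N => k%:R / N%:R * q ^- N))//.
apply: eq_big_nat => j /andP[j0 _].
rewrite exprVn -exprM natrM; field.
by rewrite ?expf_neq0// !pnatr_eq0 -!lt0n k0 j0.
Qed.

Lemma ln_lambda m :
  - ln (lambda F R m) = \sum_(1 <= k < m.+1) (num_irr F k)%:R * - ln (1 - q ^- k).
Proof.
rewrite /lambda; elim: m => [|m IH]; first by rewrite !big_nil ln1 oppr0.
have pos k : (0 < k)%N -> 0 < (1 - q ^- k) ^+ num_irr F k.
  by move=> /invq_le/andP[_ qk]; rewrite exprn_gt0//; lra.
rewrite big_nat_recr//= [RHS]big_nat_recr//= lnM ?posrE ?pos//; last first.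
  by rewrite big_nat_cond prodr_gt0// => k /andP[/andP[k0 _] _]; exact: pos.
have /andP[_ qm] := invq_le (ltn0Sn m).
rewrite opprD IH lnXn ?mulr_natl ?mulNrn//.
by move: (q ^- m.+1) qm => x qm; lra.
Qed.

Lemma lambda_gt0 m : 0 < lambda F R m.
Proof.
rewrite /lambda big_nat_cond prodr_gt0// => k /andP[/andP[/invq_le/andP[_ qk] _] _].
by rewrite exprn_gt0//; lra.
Qed.

Let sum_inv_upper a b : (a <= b)%N -> \sum_(a <= k < b) q ^- k <= 2 * q ^- a.
Proof.
move=> ab; suff : \sum_(a <= k < b) q ^- k <= 2 * q ^- a - 2 * q ^- b.
  by move/le_trans; apply; rewrite lerBlDr lerDl mulr_ge0// invr_ge0 exprn_ge0.
elim: b ab => [|b IH]; first by rewrite leqn0 => /eqP ->; rewrite big_geq// subrr.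
rewrite leq_eqVlt => /orP[/eqP <-|]; first by rewrite big_geq// subrr.
rewrite ltnS => ab; rewrite big_nat_recr//= (le_trans (lerD (IH ab) (lexx _)))//.
rewrite exprS invfM; have /andP[_] := invq_le (ltn0Sn 0); rewrite expr1.
have : 0 <= q ^- b by rewrite invr_ge0 exprn_ge0.
by move: (q ^- b) (q ^- a) (q^-1) => x y z; nra.
Qed.

Let sum_inv_lower (M h : nat) : (0 < h <= M)%N ->
  \sum_(1 <= k < h) q ^- (M - k) <= 2 * q ^- (M - h).+1.
Proof.
move=> /andP[]; case: h => // h _; elim: h => [|h IH] hM.
  by rewrite big_geq// mulr_ge0// invr_ge0 exprn_ge0.
rewrite big_nat_recr//= (le_trans (lerD (IH (ltnW hM)) (lexx _)))//.
rewrite !subnS; have : (0 < (M - h).-1)%N by rewrite -subnS subn_gt0.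
case: (M - h)%N => // -[//|k _] /=.
rewrite !exprS !invfM; have /andP[_] := invq_le (ltn0Sn 0); rewrite expr1.
have : 0 <= q ^- k by rewrite invr_ge0 exprn_ge0.
have : 0 < q^-1 by rewrite invr_gt0 q_gt0.
move: (q ^- k) (q^-1) => x z z0 x0 z2.
have : 0 <= z * x by rewrite mulr_ge0// ltW.
by nra.
Qed.

Lemma ln_lambda_bounds m : (0 < m)%N ->
  0 <= - ln (lambda F R m) - harm R m <= 8 * (m%:R * q ^+ uphalf m.+1)^-1.
Proof.
move=> m0; have m0' : 0 < m%:R :> R by rewrite ltr0n.
rewrite ln_lambda harm_sum -sumrB; set h := uphalf m.+1.
have h2m : (h.*2 <= m.+2)%N by rewrite -[h]/(m.+2./2) -geq_half_double.
have h0 : (0 < h)%N by [].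
have hm : (h <= m)%N.
  by rewrite leq_uphalf_double -addnn -addn1 leq_add2l.
have T k : (0 < k)%N ->
    0 <= - ln (1 - q ^- k) - \sum_(1 <= j < (m %/ k).+1) (q ^- k) ^+ j / j%:R <=
    2 * ((q ^- k) ^+ (m %/ k).+1 / (m %/ k).+1%:R).
  by move=> k0; apply: ln_taylor_bounds; exact: invq_le.
apply/andP; split.
  rewrite big_nat_cond sumr_ge0// => k /andP[/andP[/T/andP[k0 _] _] _].
  by rewrite -mulrBr mulr_ge0.
have B k : (0 < k)%N -> (num_irr F k)%:R * - ln (1 - q ^- k) -
    (num_irr F k)%:R * (\sum_(1 <= j < (m %/ k).+1) (q ^- k) ^+ j / j%:R) <=
    2 / m%:R * q ^- (k * (m %/ k)).
  move=> k0; have k0' : 0 < k%:R :> R by rewrite ltr0n.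
  have J0 : 0 < (m %/ k).+1%:R :> R by rewrite ltr0n.
  have /andP[_ +] := T k k0; rewrite -mulrBr => /(ler_wpM2l (ler0n R (num_irr F k))).
  move/le_trans; apply.
  rewrite exprVn -exprM mulnS exprD.
  have qk0 : 0 < q ^+ k by rewrite exprn_gt0// q_gt0.
  have qj0 : 0 < q ^+ (k * (m %/ k)) by rewrite exprn_gt0// q_gt0.
  have mk : m%:R <= k%:R * (m %/ k).+1%:R :> R.
    by rewrite -natrM ler_nat mulnC ltnW// ltn_ceil.
  have := num_irr_le F R k.
  move: (num_irr F k)%:R (ler0n R (num_irr F k)) (q ^+ k) (q ^+ (k * (m %/ k)))
    ((m %/ k).+1%:R) k%:R m%:R qk0 qj0 J0 mk k0' m0' => I I0 Q Q' J K M qk0 qj0 J0 mk k0' m0' IQ.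
  have -> : I * (2 * ((Q * Q')^-1 / J)) = 2 * Q'^-1 * ((K * I) / Q * (K * J)^-1).
    by field; rewrite !gt_eqF.
  have -> : 2 / M * Q'^-1 = 2 * Q'^-1 * (1 * M^-1) by rewrite mul1r mulrAC.
  rewrite ler_wpM2l ?mulr_ge0 ?invr_ge0 ?(ltW qj0)//.
  rewrite ler_pM ?divr_ge0 ?mulr_ge0 ?invr_ge0 ?mulr_ge0 ?(ltW qk0) ?(ltW J0) ?(ltW k0')//.
    by rewrite ler_pdivrMr// mul1r.
  by rewrite lef_pV2 ?posrE ?mulr_gt0.
have leqV a b : (a <= b)%N -> q ^- b <= q ^- a.
  move=> ab; rewrite lef_pV2 ?posrE ?exprn_gt0 ?q_gt0// ler_weXn2l//.
  by rewrite (le_trans _ (q_ge2 F R))// ler1n.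
rewrite (@big_cat_nat _ _ _ h)//=; last exact: leqW.
have -> : 8 * (m%:R * q ^+ h)^-1 = 2 / m%:R * (2 * q ^- h) + 2 / m%:R * (2 * q ^- h).
  by field; rewrite expf_neq0// gt_eqF.
have c0 : 0 <= 2 / m%:R :> R by rewrite divr_ge0.
apply: lerD.
  have hM : (0 < h <= m.+1)%N by rewrite h0 leqW.
  apply: (@le_trans _ _ (\sum_(1 <= k < h) 2 / m%:R * q ^- (m.+1 - k))); last first.
    rewrite -mulr_sumr ler_wpM2l// (le_trans (sum_inv_lower hM))// ler_wpM2l// leqV//.
    by rewrite -subSn ?leqW// leq_subRL ?addnn// ltnW// ltnS leqW.
  apply: ler_sum_nat => k /andP[k0 kh]; apply: (le_trans (B k k0)).
  by rewrite ler_wpM2l// leqV// leq_subLR -mulnS mulnC ltn_ceil.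
apply: (@le_trans _ _ (\sum_(h <= k < m.+1) 2 / m%:R * q ^- k)); last first.
  by rewrite -mulr_sumr ler_wpM2l// sum_inv_upper// leqW.
apply: ler_sum_nat => k /andP[hk]; rewrite ltnS => km; have k0 := leq_trans h0 hk.
by apply: (le_trans (B k k0)); rewrite ler_wpM2l// leqV// leq_pmulr// divn_gt0.
Qed.

End lambda_estimates.

Section harmonic.
Variable R : realType.
Local Open Scope classical_set_scope.

Lemma harm_bounds m : (0 < m)%N ->
  0 <= harm R m - ln m%:R - euler_gamma R <= m%:R^-1.
Proof.
move=> m0; have cv := @cvg_euler_gamma R.
have N0 n : (0 < n)%N -> 0 < n%:R :> R by rewrite ltr0n.
have step n : (0 < n)%N -> ln n.+1%:R - ln n%:R = ln (1 + n%:R^-1) :> R.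
  move=> n0; rewrite -ln_div ?posrE ?N0//; congr ln.
  by rewrite -natr1 mulrDl divff ?gt_eqF ?N0// mul1r.
have up n : (0 < n)%N -> ln n.+1%:R - ln n%:R <= n%:R^-1 :> R.
  move=> n0; rewrite step// le_ln1Dx// (lt_le_trans (ltrN10 R))// invr_ge0.
have lo n : (0 < n)%N -> n.+1%:R^-1 <= ln n.+1%:R - ln n%:R :> R.
  move=> n0; have n1 : 0 < n.+1%:R :> R by rewrite ltr0n.
  have : ln (1 + - n.+1%:R^-1 : R) <= - n.+1%:R^-1.
    by apply: le_ln1Dx; rewrite ltrN2 invf_lt1// ltr1n.
  have -> : 1 - n.+1%:R^-1 = n%:R / n.+1%:R :> R.
    by rewrite -(@natr1 R n) in n1 *; field; rewrite gt_eqF.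
  rewrite ln_div ?posrE ?N0//.
  by move: (ln _) (ln _) (n.+1%:R^-1) => a b c; lra.
have dec n : (m <= n)%N -> harm R n - ln n%:R <= harm R m - ln m%:R.
  elim: n => [|n IH]; first by rewrite leqn0 => /eqP ->.
  rewrite leq_eqVlt => /orP[/eqP <-//|]; rewrite ltnS => mn.
  apply: le_trans (IH mn); rewrite /harm [in leLHS]big_nat_recr//=.
  have := lo n (leq_trans m0 mn).
  by move: (\sum_(1 <= k < n.+1) _) (ln _) (ln _) (n.+1%:R^-1) => a b c d; lra.
have inc n : (m <= n)%N -> harm R m - ln m%:R - m%:R^-1 <= harm R n - ln n%:R - n%:R^-1.
  elim: n => [|n IH]; first by rewrite leqn0 => /eqP ->.
  rewrite leq_eqVlt => /orP[/eqP <-//|]; rewrite ltnS => mn.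
  apply: (le_trans (IH mn)); rewrite /harm [in leRHS]big_nat_recr//=.
  have := up n (leq_trans m0 mn).
  by move: (\sum_(1 <= k < n.+1) _) (ln _) (ln _) (n.+1%:R^-1) (n%:R^-1) => a b c d e; lra.
have g1 : euler_gamma R <= harm R m - ln m%:R.
  by apply: limr_le; [apply/cvg_ex; exists (euler_gamma R)|near=> n; apply: dec; near: n; exists m].
have g2 : harm R m - ln m%:R - m%:R^-1 <= euler_gamma R.
  apply: limr_ge; first by apply/cvg_ex; exists (euler_gamma R).
  near=> n; apply: (@le_trans _ _ (harm R n - ln n%:R - n%:R^-1)).
    by apply: inc; near: n; exists m.
  by rewrite lerBlDr lerDl.
by apply/andP; split; lra.
Unshelve. all: by end_near. Qed.

Lemma euler_gamma_bounds : 0 <= euler_gamma R <= 1.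
Proof.
have /andP[] := @harm_bounds 1 isT; rewrite /harm big_nat1 ln1 invr1.
by move=> h1 h2; apply/andP; split; lra.
Qed.

Lemma expR_harm_le m : (0 < m)%N -> expR (harm R m) <= expR 2 * m%:R.
Proof.
move=> m0; have m0' : 0 < m%:R :> R by rewrite ltr0n.
rewrite -[X in _ <= _ * X](lnK (m0' : m%:R \is Num.pos)) -expRD ler_expR.
have /andP[_] := harm_bounds m0; have /andP[_] := euler_gamma_bounds.
have : m%:R^-1 <= 1 :> R by rewrite invf_le1// ler1n.
by lra.
Qed.

Lemma natr_half_le m : (m./2)%:R <= m%:R / 2 :> R.
Proof.
rewrite ler_pdivlMr// -natrM ler_nat muln2.
by rewrite -{2}(odd_double_half m) leq_addl.
Qed.

Lemma natr_sub_half_le m : (m - m./2)%:R <= (m%:R + 1) / 2 :> R.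
Proof.
rewrite ler_pdivlMr// -natrM natr1 ler_nat muln2 -geq_uphalf_double.
by rewrite leq_subLR uphalf_half addnCA addnn odd_double_half.
Qed.

Lemma expR_chord (t L : R) : 0 <= t <= 1 -> expR (t * L) <= 1 + t * (expR L - 1).
Proof.
move=> /andP[t0 t1]; set E := expR (t * L).
have E0 : 0 < E by exact: expR_gt0.
have h1 : E * (1 + (1 - t) * L) <= expR L.
  have -> : expR L = E * expR ((1 - t) * L) by rewrite -expRD; congr expR; ring.
  by rewrite ler_wpM2l ?expR_ge1Dx// ltW.
have h2 : E * (1 - t * L) <= 1.
  have := ler_wpM2l (ltW E0) (expR_ge1Dx (- (t * L))).
  by rewrite -expRD subrr expR0.
have t1' : 0 <= 1 - t by lra.
have := ler_wpM2l t0 h1; have := ler_wpM2l t1' h2.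
have -> : 1 + t * (expR L - 1) = t * expR L + (1 - t) * 1 by ring.
have -> : E = t * (E * (1 + (1 - t) * L)) + (1 - t) * (E * (1 - t * L)) by ring.
by lra.
Qed.

End harmonic.

Section kappa.
Variables (F : finFieldType) (R : realType).
Notation q := (#|F|%:R : R).

Lemma lambda_gamma m : (0 < m)%N -> exists2 d : R, 0 <= d <= 5 / m%:R &
  lambda F R m * expR (euler_gamma R) * m%:R = expR (- d).
Proof.
move=> m0; have m0' : 0 < m%:R :> R by rewrite ltr0n.
have /andP[l1 l2] := ln_lambda_bounds F R m0.
have /andP[h1 h2] := harm_bounds R m0.
exists (- ln (lambda F R m) - euler_gamma R - ln m%:R); last first.
  rewrite -[in LHS](lnK (lambda_gt0 F R m : _ \is Num.pos)).
  rewrite -[in LHS](lnK (m0' : m%:R \is Num.pos)) -!expRD; congr expR; ring.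
have : 8 * (m%:R * q ^+ uphalf m.+1)^-1 <= 4 / m%:R.
  rewrite invfM mulrCA mulrC ler_wpM2r ?invr_ge0//.
  have := @invq_le F R (uphalf m.+1) isT; move: (q ^- _) => x; lra.
move: (8 * _) l2 => x l2 x4.
have -> : 5 / m%:R = 4 / m%:R + m%:R^-1 :> R by field; rewrite gt_eqF.
by apply/andP; split; lra.
Qed.

End kappa.

Section rankin.
Variables (F : finFieldType) (R : realType).
Notation q := (#|F|%:R : R).

Let majorant (f g : {poly R}) := forall i, `|f`_i| <= g`_i.

Let majorant1 : majorant 1 1.
Proof. by move=> i; rewrite coef1 ger0_norm. Qed.

Let majorantM f1 g1 f2 g2 :
  majorant f1 g1 -> majorant f2 g2 -> majorant (f1 * f2) (g1 * g2).
Proof.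
move=> h1 h2 i; rewrite !coefM; apply: (le_trans (ler_norm_sum _ _ _)).
by apply: ler_sum => j _; rewrite normrM ler_pM.
Qed.

Let sieve_majorant m : {poly R} :=
  \prod_(1 <= k < m.+1) (1 + q ^- k *: 'X^k) ^+ num_irr F k.

Let sieve_majorantP m : majorant (sieve_poly F R m) (sieve_majorant m).
Proof.
rewrite /sieve_poly /sieve_majorant; apply: (big_ind2 majorant) => //.
move=> k _; elim: (num_irr F k) => [|I IH]; first by rewrite !expr0.
rewrite !exprS; apply: majorantM => // i.
rewrite coefB coefD coef1 coefZ coefXn (le_trans (ler_normB _ _))//.
by rewrite !ger0_norm// mulr_ge0// invr_ge0 exprn_ge0.
Qed.

Let sieve_majorant_le m (rho : R) : 0 <= rho ->
  (sieve_majorant m).[rho] <= expR (\sum_(1 <= k < m.+1) rho ^+ k / k%:R).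
Proof.
move=> rho0; rewrite /sieve_majorant horner_prod expR_sum.
rewrite big_nat_cond [leRHS]big_nat_cond; apply: ler_prod => k /andP[/andP[k0 _] _].
have k0' : 0 < k%:R :> R by rewrite ltr0n.
have qk : 0 < q ^+ k by rewrite exprn_gt0// q_gt0.
have x0 : 0 <= rho ^+ k / q ^+ k by rewrite divr_ge0 ?exprn_ge0 ?(ltW qk).
rewrite horner_exp !hornerE mulrC exprn_ge0/=; last by rewrite addr_ge0.
apply: (@le_trans _ _ (expR (rho ^+ k / q ^+ k) ^+ num_irr F k)).
  by rewrite lerXn2r ?nnegrE ?expR_ge0 ?addr_ge0 ?expR_ge1Dx.
rewrite -expRM_natl ler_expR ler_pdivlMr//.
have := num_irr_le F R k; move: (num_irr F k)%:R => I IQ.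
have -> : I * (rho ^+ k / q ^+ k) * k%:R = (k%:R * I) / q ^+ k * rho ^+ k by ring.
by rewrite ler_piMl ?exprn_ge0// ler_pdivrMr// mul1r.
Qed.

(* Rankin's trick: [rho ^+ n <= rho ^+ j] for [j > n]. *)
Lemma rough_prop_rankin n m (rho : R) : 1 <= rho ->
  `|rough_prop F R n m - lambda F R m| <=
  rho ^- n * expR (\sum_(1 <= k < m.+1) rho ^+ k / k%:R).
Proof.
move=> rho1; have rho0 : 0 < rho by rewrite (lt_le_trans ltr01).
set P := sieve_poly F R m; set Q := sieve_majorant m.
pose N := (maxn n.+1 (maxn (size P) (size Q))).
have nN : (n.+1 <= N)%N by rewrite leq_maxl.
have PN : (size P <= N)%N by rewrite /N !leq_max leqnn orbT.
have QN : (size Q <= N)%N by rewrite /N !leq_max leqnn !orbT.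
rewrite rough_propE lambdaE -/P (horner_coef_wide _ PN).
under [X in _ - X]eq_bigr do rewrite expr1n mulr1.
rewrite -!(big_mkord xpredT (fun i => P`_i)) (@big_cat_nat _ _ _ n.+1 0 N)//=.
rewrite opprD addrA subrr add0r normrN (le_trans (ler_norm_sum _ _ _))//.
rewrite ler_pdivlMl ?exprn_gt0// mulr_sumr.
apply: le_trans (sieve_majorant_le m (ltW rho0)).
rewrite -/Q (horner_coef_wide _ QN) -(big_mkord xpredT (fun i => Q`_i * rho ^+ i)).
have Q0 i : 0 <= Q`_i by rewrite (le_trans _ (sieve_majorantP m i)).
rewrite [leRHS](@big_cat_nat _ _ _ n.+1)//= -[leLHS]add0r lerD//.
  by rewrite sumr_ge0// => i _; rewrite mulr_ge0// exprn_ge0// ltW.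
apply: ler_sum_nat => i /andP[ni _]; rewrite mulrC ler_pM ?exprn_ge0 ?(ltW rho0)//.
  exact: sieve_majorantP.
by rewrite ler_weXn2l// ltnW.
Qed.

Section saddle.
Variables (n m : nat).
Hypotheses (m0 : (0 < m)%N) (mn : (m <= n)%N).
Let u : R := n%:R / m%:R.
Let L := ln u.
Let rho := expR (L / m%:R).

Let m0' : 0 < m%:R :> R. Proof. by rewrite ltr0n. Qed.
Let u1 : 1 <= u. Proof. by rewrite ler_pdivlMr// mul1r ler_nat. Qed.
Let u0 : 0 < u. Proof. by rewrite (lt_le_trans ltr01). Qed.
Let L0 : 0 <= L. Proof. exact: ln_ge0. Qed.
Let rho1 : 1 <= rho.
Proof. by rewrite -expR0 ler_expR divr_ge0// ltW. Qed.
Let rhoX k : rho ^+ k = expR (k%:R / m%:R * L).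
Proof. by rewrite -expRM_natl; congr expR; ring. Qed.
Let rhon : rho ^- n = expR (- (u * L)).
Proof. by rewrite rhoX expRN. Qed.
Let expL : expR L = u. Proof. by rewrite lnK. Qed.

Let split_sum : \sum_(1 <= k < m.+1) rho ^+ k / k%:R =
  harm R m + \sum_(1 <= k < m.+1) (rho ^+ k - 1) / k%:R.
Proof.
rewrite /harm -big_split/=; apply: eq_bigr => k _.
by rewrite mulrBl mul1r addrC subrK.
Qed.

Let chord1 k : (0 < k <= m)%N -> (rho ^+ k - 1) / k%:R <= (u - 1) / m%:R.
Proof.
move=> /andP[k0 km]; have k0' : 0 < k%:R :> R by rewrite ltr0n.
rewrite ler_pdivrMr// lerBlDl rhoX -expL.
have -> : (expR L - 1) / m%:R * k%:R = k%:R / m%:R * (expR L - 1) by ring.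
apply: expR_chord; rewrite divr_ge0 ?ler_pdivrMr ?mul1r ?ler_nat//=.
Qed.

Lemma rough_prop_sub_lambda_le :
  `|rough_prop F R n m - lambda F R m| <= expR 2 * m%:R * expR (u - u * ln u).
Proof.
apply: (le_trans (rough_prop_rankin _ _ rho1)).
rewrite rhon split_sum expRD mulrCA -expRD.
apply: ler_pM; [exact: expR_ge0|exact: expR_ge0|exact: expR_harm_le|].
rewrite ler_expR addrC -/L lerD2r.
apply: (@le_trans _ _ (\sum_(1 <= k < m.+1) (u - 1) / m%:R)).
  exact: ler_sum_nat.
rewrite sumr_const_nat subn1/= -[_ *+ m]mulr_natr divfK ?gt_eqF//.
by rewrite gerBl.
Qed.

Lemma rough_prop_sub_lambda_le_gain : (10 <= m)%N -> 16 <= u ->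
  `|rough_prop F R n m - lambda F R m| <=
  expR 2 * m%:R * expR (4 / 5 * u - u * ln u).
Proof.
move=> m10 u16; apply: (le_trans (rough_prop_rankin _ _ rho1)).
rewrite rhon split_sum expRD mulrCA -expRD.
apply: ler_pM; [exact: expR_ge0|exact: expR_ge0|exact: expR_harm_le|].
rewrite ler_expR addrC -/L lerD2r.
have m10' : 10 <= m%:R :> R by rewrite ler_nat.
pose s := expR (L / 2).
have ss : s * s = u by rewrite -expRD -splitr expL.
have s0 : 0 < s := expR_gt0 _.
have s4 : 4 <= s by nra.
have chord2 k : (0 < k)%N -> (k.*2 <= m)%N ->
    (rho ^+ k - 1) / k%:R <= 2 * (s - 1) / m%:R.
  move=> k0 km; have k0' : 0 < k%:R :> R by rewrite ltr0n.
  rewrite ler_pdivrMr// lerBlDl rhoX.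
  have -> : k%:R / m%:R * L = (2 * k%:R / m%:R) * (L / 2).
    by field; rewrite gt_eqF.
  have -> : 2 * (s - 1) / m%:R * k%:R = 2 * k%:R / m%:R * (s - 1) by ring.
  apply: expR_chord; rewrite divr_ge0 ?mulr_ge0 ?ler_pdivrMr ?mul1r//=.
  by rewrite -natrM ler_nat mul2n.
rewrite (@big_cat_nat _ _ _ m./2.+1)//=; last first.
  by rewrite ltnS -{2}(odd_double_half m) -addnn addnA leq_addl.
apply: (@le_trans _ _ (\sum_(1 <= k < m./2.+1) 2 * (s - 1) / m%:R +
    \sum_(m./2.+1 <= k < m.+1) (u - 1) / m%:R)).
  apply: lerD; apply: ler_sum_nat => k /andP[k1 k2].
    by apply: chord2 => //; rewrite -geq_half_double.
  by apply: chord1; rewrite (leq_trans _ k1).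
have cst a b (c : R) : \sum_(a <= k < b) c = c * (b - a)%:R.
  by rewrite sumr_const_nat mulr_natr.
rewrite !cst subn1/= subSS.
have e1 := natr_half_le R m; have e2 := natr_sub_half_le R m.
have i0 : 0 < m%:R^-1 :> R by rewrite invr_gt0.
have i1 : m%:R^-1 * m%:R = 1 :> R by rewrite mulVf// gt_eqF.
have i2 : m%:R^-1 <= 10^-1 :> R by rewrite lef_pV2 ?posrE.
have a1 : 2 * (s - 1) / m%:R * (m./2)%:R <= s - 1.
  apply: (@le_trans _ _ (2 * (s - 1) / m%:R * (m%:R / 2))).
    by rewrite ler_wpM2l// divr_ge0 ?mulr_ge0//; lra.
  by rewrite le_eqVlt; apply/orP; left; apply/eqP; field; rewrite gt_eqF.
have a2 : (u - 1) / m%:R * (m - m./2)%:R <= (u - 1) * (1 / 2 + 1 / 20).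
  apply: (@le_trans _ _ ((u - 1) / m%:R * ((m%:R + 1) / 2))).
    by rewrite ler_wpM2l// divr_ge0//; lra.
  rewrite -mulrA ler_wpM2l//; first by lra.
  by rewrite mulrA mulrDr i1 mulr1; lra.
have : s <= u / 4 by rewrite -ss; nra.
by lra.
Qed.

End saddle.
End rankin.

(** * Buchstab's function *)

Section weight.
Variable R : realType.

(* [weight 0 u] is [(u / e) `^ (- u)]. *)
Definition weight (a u : R) : R := expR ((1 - a) * u - u * ln u).

Lemma weight_gt0 a u : 0 < weight a u. Proof. exact: expR_gt0. Qed.

Lemma weight_shift (a y s : R) : 0 < y -> s < y ->
  weight a (y - s) <= weight a y * expR (s * (ln y + a)).
Proof.
move=> y0 sy; have ys : 0 < y - s by lra.
rewrite -expRD ler_expR.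
have h : ln y - ln (y - s) <= s / (y - s).
  rewrite -ln_div ?posrE//.
  have -> : y / (y - s) = 1 + s / (y - s) by field; rewrite gt_eqF.
  apply: le_ln1Dx; have -> : s / (y - s) = y / (y - s) - 1 by field; rewrite gt_eqF.
  have p : 0 < y / (y - s) by rewrite divr_gt0.
  lra.
have : (y - s) * (ln y - ln (y - s)) <= s.
  by rewrite mulrC -ler_pdivlMr.
by move: (ln y) (ln _) => A B AB; lra.
Qed.

Lemma weight_le (a x y : R) : 0 <= a -> 1 <= x -> x <= y -> weight a y <= weight a x.
Proof.
move=> a0 x1 xy; have -> : y = x - (x - y) by ring.
have x0 : 0 < x by lra.
apply: (le_trans (weight_shift _ x0 _)); first by lra.
rewrite ger_pMr ?weight_gt0// expR_le1 mulr_le0_ge0//; first by lra.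
by rewrite addr_ge0// ln_ge0.
Qed.

Lemma weight_add_le (a y s : R) : 0 <= a -> 1 <= y -> 0 <= s ->
  weight a (y + s) <= weight a y * expR (- (s * ln y)).
Proof.
move=> a0 y1 s0; have -> : y + s = y - (- s) by ring.
apply: (le_trans (weight_shift _ _ _)); [by lra|by lra|].
rewrite (ler_wpM2l (ltW (weight_gt0 _ _)))// ler_expR.
by have := ln_ge0 y1; nra.
Qed.

Lemma weight0_sub1 (y : R) : 1 < y -> weight 0 (y - 1) <= y * weight 0 y.
Proof.
move=> y1; have y0 : 0 < y by lra.
apply: (le_trans (weight_shift _ y0 y1)).
by rewrite mul1r addr0 lnK// mulrC.
Qed.

Lemma expR_fourth : expR (4^-1) <= 4 / 3 :> R.
Proof.
have := expR_ge1Dx (- 4^-1 : R); rewrite expRN => h.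
have E : 0 < expR (4^-1 : R) := expR_gt0 _.
by have : expR (4^-1) * (expR (4^-1))^-1 = 1 :> R; [rewrite divff// gt_eqF|nra].
Qed.

Lemma expR_eighth : expR (8^-1) <= 8 / 7 :> R.
Proof.
have := expR_ge1Dx (- 8^-1 : R); rewrite expRN => h.
have E : 0 < expR (8^-1 : R) := expR_gt0 _.
by have : expR (8^-1) * (expR (8^-1))^-1 = 1 :> R; [rewrite divff// gt_eqF|nra].
Qed.

Lemma weight_sub1 (y : R) : 1 < y -> weight 4^-1 (y - 1) <= 4 / 3 * y * weight 4^-1 y.
Proof.
move=> y1; have y0 : 0 < y by lra.
apply: (le_trans (weight_shift _ y0 y1)).
rewrite mul1r expRD lnK// mulrC (ler_wpM2r (ltW (weight_gt0 _ _)))// [leRHS]mulrC.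
by rewrite ler_wpM2l ?expR_fourth// (ltW y0).
Qed.

Lemma weight_subhalf (a y : R) : a <= 4^-1 -> 16 <= y ->
  weight a (y - 2^-1) <= 2 / 7 * y * weight a y.
Proof.
move=> a4 y16; have y0 : 0 < y by lra.
apply: (le_trans (weight_shift _ y0 _)); first by lra.
rewrite mulrC (ler_wpM2r (ltW (weight_gt0 _ _)))// mulrDr expRD.
have h1 : expR (2^-1 * a) <= 8 / 7.
  by apply: le_trans expR_eighth; rewrite ler_expR; lra.
set s := expR (2^-1 * ln y).
have ss : s * s = y by rewrite -expRD -[in RHS](lnK (y0 : y \is Num.pos)); congr expR; field.
have s0 : 0 < s := expR_gt0 _.
have s4 : 4 <= s by nra.
have h2 : s <= y / 4 by rewrite -ss; nra.
have -> : 2 / 7 * y = y / 4 * (8 / 7) by field.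
by rewrite ler_pM ?expR_ge0.
Qed.

Lemma weight_mean (y : R) : 16 <= y ->
  (weight 4^-1 (y - 1) + weight 4^-1 (y - 2^-1)) / 2 <= y * weight 4^-1 y.
Proof.
move=> y16; have y1 : 1 < y by lra.
have := weight_sub1 y1; have := weight_subhalf (lexx _) y16.
have := weight_gt0 4^-1 y; move: (weight _ _) (weight _ _) (weight _ _) => A B C *; nra.
Qed.

End weight.

Section buchstab_estimates.
Variable R : realType.
Local Open Scope classical_set_scope.
Notation w := (@buchstab R).

Lemma buchstab_itv12 (u : R) : 1 <= u <= 2 -> w u = u^-1.
Proof. by have [_ + _ _] := @buchstabP R; exact. Qed.

Lemma buchstab_mul_derive (u : R) : 2 < u ->
  is_derive u 1 (fun v => v * w v) (w (u - 1)).
Proof. by have [_ _ _ +] := @buchstabP R; exact. Qed.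

Lemma buchstab_continuous (a b : R) : 1 <= a -> {within `[a, b], continuous w}.
Proof.
move=> a1; have [_ _ + _] := @buchstabP R; apply: continuous_subspaceW.
by move=> x /=; rewrite !in_itv/= andbT => /andP[ax _]; lra.
Qed.

Lemma buchstab_mul_continuous (a b : R) : 1 <= a ->
  {within `[a, b], continuous (fun v => v * w v)}.
Proof.
move=> a1 x; apply: cvgM; last exact: (buchstab_continuous a1).
by move: x; apply: continuous_subspaceT => v; exact: cvg_id.
Qed.

Lemma buchstab_derive (u : R) : 2 < u -> is_derive u 1 w ((w (u - 1) - w u) / u).
Proof.
move=> u2; have u0 : u != 0 by rewrite gt_eqF//; lra.
have d1 := buchstab_mul_derive u2.
have d2 : is_derive u 1 (fun v : R => v^-1) (- u ^- 2).
  have := @is_deriveV _ id u 1 1 u0 (is_derive_id _ _).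
  by rewrite -[_ *: _]/(_ * _) mulr1.
have d3 := is_deriveM d1 d2.
have {}d3 : is_derive u 1 (fun v => v * w v * v^-1) ((w (u - 1) - w u) / u).
  apply: (is_derive_eq d3); rewrite -![_ *: _]/(_ * _).
  by field.
apply: near_eq_is_derive d3; near=> v.
have v2 : 2 < v by near: v; exact: lt_nbhsr.
by field; rewrite gt_eqF//; lra.
Unshelve. all: by end_near. Qed.

Lemma buchstab_bounds (u : R) : 1 <= u -> 2^-1 <= w u <= 1.
Proof.
suff H (n : nat) v : 1 <= v <= n.+2%:R -> 2^-1 <= w v <= 1.
  move=> u1; apply: (H (Num.truncn `|u|)); rewrite u1/=.
  rewrite (le_trans (ler_norm u))// ltW// (lt_le_trans (truncnS_gt `|u|))//.
  by rewrite ler_nat.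
elim: n v => [|n IH] v /andP[v1 vn].
  by rewrite buchstab_itv12 ?v1// invf_le1 ?lef_pV2 ?posrE ?v1 ?vn//; lra.
have [v2|v2] := leP v 2.
  by apply: IH; rewrite v1 (le_trans v2)// ler_nat.
have w2 : w 2 = 2^-1 by rewrite buchstab_itv12 ?lexx ?andbT ?ler1n.
have wb x : 2 < x < v -> 2^-1 <= w (x - 1) <= 1.
  move=> /andP[x2 xv]; apply: IH; apply/andP; split; first by lra.
  by move: vn; rewrite -(@natr1 R n.+2); lra.
have idc (c : R) : {within `[2, v], continuous (fun z : R => c * z)}.
  by apply: continuous_subspaceT => z; apply: cvgM; [exact: cvg_cst|exact: cvg_id].
have idd (c x : R) : is_derive x 1 (fun z : R => c * z) c.
  have -> : (fun z : R => c * z) = c \*: (id : R -> R) by [].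
  by apply: is_derive_eq; rewrite -[_ *: _]/(_ * _) mulr1.
have mc : {within `[2, v], continuous (fun z => z * w z)}.
  by apply: buchstab_mul_continuous; lra.
have lo : 2 * w 2 - 2^-1 * 2 <= v * w v - 2^-1 * v.
  apply: (@derive_ge0_le R (fun z => z * w z - 2^-1 * z) (fun z => w (z - 1) - 2^-1)).
  - exact: ltW.
  - move=> x /andP[x2 _]; have dx := buchstab_mul_derive x2.
    by have dc := idd 2^-1 x; apply: is_deriveB.
  - by move=> x; apply: cvgB; [exact: mc|exact: idc].
  - by move=> x /wb/andP[xl _]; rewrite subr_ge0.
have hi : 1 * 2 - 2 * w 2 <= 1 * v - v * w v.
  apply: (@derive_ge0_le R (fun z => 1 * z - z * w z) (fun z => 1 - w (z - 1))).
  - exact: ltW.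
  - move=> x /andP[x2 _]; have dx := buchstab_mul_derive x2.
    by have dc := idd 1 x; apply: is_deriveB.
  - by move=> x; apply: cvgB; [exact: idc|exact: mc].
  - by move=> x /wb/andP[_ xl]; rewrite subr_ge0.
move: lo hi; rewrite w2 => lo hi; apply/andP; split; nra.
Qed.

Lemma buchstab_lip_derive (K a b : R) : 2 <= a -> a <= b ->
  (forall x, a < x < b -> `|w (x - 1) - w x| <= K * x) ->
  `|w b - w a| <= K * (b - a).
Proof.
move=> a2; rewrite le_eqVlt => /predU1P[<-|ab] H; first by rewrite !subrr mulr0 normr0.
have wd x : x \in `]a, b[%R -> is_derive x 1 w ((w (x - 1) - w x) / x).
  by rewrite in_itv/= => /andP[ax _]; apply: buchstab_derive; lra.
have wc : {within `[a, b], continuous w} by apply: buchstab_continuous; lra.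
have [c] := MVT ab wd wc; rewrite in_itv/= => cab ->.
have c0 : 0 < c by case/andP: cab => ? _; lra.
rewrite normrM [X in _ * X]ger0_norm ?subr_ge0 ?(ltW ab)//.
rewrite ler_wpM2r ?subr_ge0 ?(ltW ab)// normrM normfV [X in _ / X]gtr0_norm//.
by rewrite ler_pdivrMr// H.
Qed.

Lemma buchstab_lip1 (a b : R) : 1 <= a -> a <= b -> `|w b - w a| <= b - a.
Proof.
have L12 (x y : R) : 1 <= x -> x <= y -> y <= 2 -> `|w y - w x| <= y - x.
  move=> x1 xy y2; rewrite !buchstab_itv12; [|by lra|by lra].
  have -> : y^-1 - x^-1 = - ((y - x) / (x * y)) by field; rewrite !gt_eqF//; lra.
  have xy1 : 1 <= x * y by nra.
  rewrite normrN ger0_norm; first by rewrite ler_pdivrMr; [nra|lra].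
  by rewrite divr_ge0//; lra.
have L2 (x y : R) : 2 <= x -> x <= y -> `|w y - w x| <= y - x.
  move=> x2 xy; rewrite -[leRHS]mul1r; apply: buchstab_lip_derive => // z /andP[xz _].
  have z0 : 1 <= z - 1 by lra.
  have z1 : 1 <= z by lra.
  have /andP[? ?] := buchstab_bounds z0; have /andP[? ?] := buchstab_bounds z1.
  by rewrite ler_norml; apply/andP; split; lra.
move=> a1 ab; have [b2|b2] := leP b 2; first exact: L12.
have [a2|/ltW a2] := leP 2 a; first exact: L2.
have := L12 _ _ a1 a2 (lexx 2); have := L2 _ _ (lexx 2) (ltW b2).
move=> h1 h2; apply: (le_trans (ler_distD (w 2) _ _)); lra.
Qed.

Notation G := (weight (4^-1 : R)).
Let A : R := (G 16)^-1.

Let A0 : 0 < A. Proof. by rewrite invr_gt0 weight_gt0. Qed.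

Let G_le (x y : R) : 1 <= x -> x <= y -> G y <= G x.
Proof. by move=> *; apply: weight_le => //; lra. Qed.

(* The decay is propagated from [a <= k] to [a <= k + 1 / 2] because
   [x w'(x) = w (x - 1) - w x] only involves the weaker bound, valid everywhere,
   of the previous stage. *)
Let lip_stage (j : nat) (a b : R) : 1 <= a -> a <= b ->
  `|w b - w a| <= A * G (Num.min a (16 + j%:R / 2)) * (b - a).
Proof.
elim: j a b => [|j IH] a b a1 ab.
  apply: (le_trans (buchstab_lip1 a1 ab)); rewrite -[leLHS]mul1r.
  rewrite ler_wpM2r ?subr_ge0// /A mulrC ler_pdivlMr ?weight_gt0// mul1r.
  rewrite mul0r addr0; apply: G_le; last by rewrite ge_min lexx orbT.
  by rewrite le_min a1/= ler1n.
set k := 16 + j%:R / 2 : R; set k' := 16 + j.+1%:R / 2 : R.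
have kk' : k' = k + 2^-1 by rewrite /k' -natr1 /k; field.
have k16 : 16 <= k by rewrite lerDl divr_ge0.
have [ak|ka] := leP a k.
  have := IH a b a1 ab; rewrite !min_l//; lra.
set y := Num.min a k'.
have y16 : 16 <= y by rewrite le_min; apply/andP; split; lra.
have ya : y <= a by rewrite ge_min lexx.
have yk : y <= k + 2^-1 by rewrite -kk' ge_min lexx orbT.
apply: buchstab_lip_derive => //; first by lra.
move=> x /andP[ax xb].
have h1 := IH (x - 1) (x - 2^-1) ltac:(lra) ltac:(lra).
have h2 := IH (x - 2^-1) x ltac:(lra) ltac:(lra).
have g1 : G (Num.min (x - 1) k) <= G (y - 1).
  by apply: G_le; [lra|rewrite le_min; apply/andP; split; lra].
have g2 : G (Num.min (x - 2^-1) k) <= G (y - 2^-1).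
  by apply: G_le; [lra|rewrite le_min; apply/andP; split; lra].
have d1 : x - 2^-1 - (x - 1) = 2^-1 by field.
have d2 : x - (x - 2^-1) = 2^-1 by ring.
rewrite {}d1 -/k in h1; rewrite {}d2 -/k in h2.
have gm := weight_mean y16.
have {}h1 : `|w (x - 2^-1) - w (x - 1)| <= A * G (y - 1) * 2^-1.
  by apply: (le_trans h1); rewrite ler_wpM2r ?invr_ge0// ler_wpM2l// (ltW A0).
have {}h2 : `|w x - w (x - 2^-1)| <= A * G (y - 2^-1) * 2^-1.
  by apply: (le_trans h2); rewrite ler_wpM2r ?invr_ge0// ler_wpM2l// (ltW A0).
rewrite distrC; apply: (le_trans (ler_distD (w (x - 2^-1)) _ _)).
apply: (le_trans (lerD h2 h1)).
have -> : A * G (y - 2^-1) * 2^-1 + A * G (y - 1) * 2^-1 =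
  A * ((G (y - 1) + G (y - 2^-1)) / 2) by field.
rewrite -mulrA ler_wpM2l ?(ltW A0)// (le_trans gm)// mulrC.
by rewrite ler_wpM2l ?(ltW (weight_gt0 _ _))//; lra.
Qed.

Lemma buchstab_lip : exists2 K : R, 0 < K & forall a b, 1 <= a -> a <= b ->
  `|w b - w a| <= K * G a * (b - a).
Proof.
exists A => // a b a1 ab; pose j := Num.truncn `|2 * a|.
have := lip_stage j.+1 a1 ab; rewrite min_l//.
have : a * 2 <= j.+1%:R.
  by rewrite mulrC (le_trans (ler_norm _))// ltW// truncnS_gt.
lra.
Qed.

Lemma buchstab_sub_le : exists2 K : R, 0 < K & forall a b, 16 <= a -> a <= b ->
  `|w b - w a| <= K * G a.
Proof.
have [K K0 HK] := buchstab_lip; exists (2 * K); first by rewrite mulr_gt0.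
suff H (n : nat) a b : 16 <= a -> a <= b -> b <= a + n%:R ->
    `|w b - w a| <= 2 * K * G a.
  move=> a b a16 ab; apply: (H (Num.truncn `|b - a|).+1) => //.
  rewrite -lerBlDl; apply: (le_trans (ler_norm _)); exact/ltW/truncnS_gt.
elim: n a b => [|n IH] a b a16 ab bn.
  have -> : b = a by lra.
  by rewrite subrr normr0 !mulr_ge0 ?(ltW K0) ?(ltW (weight_gt0 _ _)).
have a1 : 1 <= a by lra.
have KG : 0 < K * G a by rewrite mulr_gt0 ?weight_gt0.
have [ba|/ltW ba] := leP b (a + 1).
  apply: (le_trans (HK a b a1 ab)).
  by move: KG; rewrite -[2 * K * _]mulrA; move: (K * G a) => c c0; nra.
apply: (le_trans (ler_distD (w (a + 1)) _ _)).
have h1 : `|w (a + 1) - w a| <= K * G a.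
  by have := HK a (a + 1) a1 ltac:(lra); rewrite addrAC subrr add0r mulr1.
have h2 := IH (a + 1) b ltac:(lra) ba ltac:(by move: bn; rewrite -natr1; lra).
have h3 : G (a + 1) <= G a * 2^-1.
  apply: (le_trans (weight_add_le _ a1 ler01)); first by rewrite invr_ge0.
  rewrite mul1r (ler_wpM2l (ltW (weight_gt0 _ _)))// expRN lnK ?posrE; last by lra.
  by rewrite lef_pV2 ?posrE//; lra.
apply: (le_trans (lerD h2 h1)).
apply: (le_trans (lerD (ler_wpM2l (_ : 0 <= 2 * K) h3) (lexx _))).
  by rewrite mulr_ge0 ?(ltW K0).
by move: (G a) => g; rewrite le_eqVlt; apply/orP; left; apply/eqP; field.
Qed.

Lemma buchstab_grid (m n : nat) : (0 < m)%N -> (m.*2 <= n)%N ->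
  exists2 x : R, 0 <= x <= m%:R^-1 &
  n.+1%:R * w (n.+1%:R / m%:R) - n%:R * w (n%:R / m%:R) =
  w ((n - m)%:R / m%:R + x).
Proof.
move=> m0 mn; have m0' : 0 < m%:R :> R by rewrite ltr0n.
set v : R := n%:R / m%:R; have v2 : 2 <= v.
  by rewrite ler_pdivlMr// -natrM ler_nat mul2n.
have vS : n.+1%:R / m%:R = v + m%:R^-1 :> R by rewrite -natr1 mulrDl mul1r.
have vlt : v < v + m%:R^-1 by rewrite ltrDl invr_gt0.
have wd x : x \in `]v, v + m%:R^-1[%R -> is_derive x 1 (fun z => z * w z) (w (x - 1)).
  by rewrite in_itv/= => /andP[vx _]; apply: buchstab_mul_derive; lra.
have wc : {within `[v, v + m%:R^-1], continuous (fun z => z * w z)}.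
  by apply: buchstab_mul_continuous; lra.
have [c] := MVT vlt wd wc; rewrite in_itv/= => /andP[c1 c2] cE.
exists (c - v); first by apply/andP; split; lra.
have -> : (n - m)%:R / m%:R = v - 1 :> R.
  rewrite natrB; last by rewrite (leq_trans _ mn)// -addnn leq_addr.
  by rewrite mulrBl divff ?gt_eqF.
have -> : v - 1 + (c - v) = c - 1 by ring.
have nE : n%:R = m%:R * v :> R by rewrite /v mulrC divfK ?gt_eqF.
have nE' : n.+1%:R = m%:R * (v + m%:R^-1) :> R.
  by rewrite -vS mulrC divfK ?gt_eqF.
rewrite vS; clearbody v; rewrite nE nE' -!mulrA -mulrBr cE [v + _]addrC addrK.
by rewrite mulrCA divff ?mulr1 ?gt_eqF.
Qed.

End buchstab_estimates.

(** * The recursion for the error term *)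

Section recursion.
Variable R : realType.
Implicit Types (F : finFieldType) (m n : nat).
Notation w := (@buchstab R).
Notation r F n m := (rough_prop F R n m).

Definition sieve_tail m : R := 10 * expR (- (m%:R / 4)).

Lemma sieve_tail_gt0 m : 0 < sieve_tail m.
Proof. by rewrite mulr_gt0 ?expR_gt0. Qed.

Lemma sum_sieve_coef F m n k : (k <= n)%N ->
  \sum_(1 <= j < k.+1) (sieve_poly F R m)`_(n.+1 - j) = r F n m - r F (n - k) m.
Proof.
elim: k => [|k IH] kn; first by rewrite big_geq// subn0 subrr.
rewrite big_nat_recr//= IH ?(ltnW kn)// subSS.
have -> : (n - k = (n - k.+1).+1)%N by rewrite subnSK.
by rewrite rough_propS; ring.
Qed.

Lemma sieve_coef_le1 F m n : `|(sieve_poly F R m)`_n| <= 1.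
Proof.
case: n => [|n]; first by rewrite sieve_poly0 normr1.
have -> : (sieve_poly F R m)`_n.+1 = r F n.+1 m - r F n m.
  by rewrite rough_propS; ring.
have := rough_prop_ge0 F R n m; have := rough_prop_le1 F R n m.
have := rough_prop_ge0 F R n.+1 m; have := rough_prop_le1 F R n.+1 m.
by move=> *; rewrite ler_norml; apply/andP; split; lra.
Qed.

Lemma log_deriv_coef_tail F m j : (m < j)%N ->
  log_deriv_coef F R m j <= 2 * expR (- 4^-1) ^+ j.
Proof.
move=> mj; apply: (le_trans (log_deriv_coef_le F R mj)); rewrite ler_wpM2l//.
set h := uphalf j.
have q2 := q_ge2 F R.
apply: (@le_trans _ _ (2^-1 ^+ h)).
  by rewrite -exprVn lerXn2r ?nnegrE ?invr_ge0// lef_pV2 ?posrE// (lt_le_trans _ q2).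
have e2 : 2^-1 <= expR (- 2^-1 : R).
  by have := expR_ge1Dx (- 2^-1 : R); lra.
apply: (@le_trans _ _ (expR (- 2^-1) ^+ h)).
  by rewrite lerXn2r ?nnegrE ?expR_ge0.
rewrite -!expRM_natl ler_expR.
have jh : j%:R <= 2 * h%:R :> R.
  by rewrite -natrM ler_nat mul2n -leq_uphalf_double.
by lra.
Qed.

Lemma sum_expR_fourth a b :
  \sum_(a <= j < b) expR (- 4^-1 : R) ^+ j <= 5 * expR (- 4^-1) ^+ a.
Proof.
have y0 : 0 < expR (- 4^-1 : R) := expR_gt0 _.
have y1 : expR (- 4^-1 : R) <= 4 / 5.
  have := expR_ge1Dx (4^-1 : R); rewrite expRN => h.
  have E : 0 < expR (4^-1 : R) := expR_gt0 _.
  have -> : 4 / 5 = (1 + 4^-1)^-1 :> R by field.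
  by rewrite lef_pV2 ?posrE.
move: (expR _) y0 y1 => y y0 y1.
have [ab|/ltnW ba] := leqP a b; last by rewrite big_geq// mulr_ge0// exprn_ge0// ltW.
suff : \sum_(a <= j < b) y ^+ j <= 5 * y ^+ a - 5 * y ^+ b.
  by move/le_trans; apply; rewrite lerBlDr lerDl mulr_ge0// exprn_ge0// ltW.
elim: b ab => [|b IH]; first by rewrite leqn0 => /eqP ->; rewrite big_geq// subrr.
rewrite leq_eqVlt => /orP[/eqP <-|]; first by rewrite big_geq// subrr.
rewrite ltnS => ab; rewrite big_nat_recr//= (le_trans (lerD (IH ab) (lexx _)))//.
rewrite exprS; have : 0 < y ^+ b by rewrite exprn_gt0.
by move: (y ^+ b) (y ^+ a) => B A B0; nra.
Qed.

(* For [sieve_tail m = 0] this would be the recursion counting the permutations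
   of [n] points all of whose cycles are longer than [m]. *)
Lemma rough_prop_rec F m n : (m <= n)%N -> exists2 s : R, `|s| <= sieve_tail m &
  n.+1%:R * (r F n.+1 m - r F n m) = r F (n - m) m - r F n m - s.
Proof.
move=> mn; exists (\sum_(m.+1 <= j < n.+2)
    log_deriv_coef F R m j * (sieve_poly F R m)`_(n.+1 - j)).
  apply: (le_trans (ler_norm_sum _ _ _)).
  apply: (@le_trans _ _ (\sum_(m.+1 <= j < n.+2) 2 * expR (- 4^-1) ^+ j)).
    apply: ler_sum_nat => j /andP[mj _]; rewrite normrM.
    rewrite ger0_norm ?log_deriv_coef_ge0// -[leRHS]mulr1.
    by rewrite ler_pM ?log_deriv_coef_ge0 ?log_deriv_coef_tail ?sieve_coef_le1.
  rewrite -mulr_sumr (le_trans (ler_wpM2l _ (sum_expR_fourth _ _)))//.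
  rewrite /sieve_tail mulrA -natrM ler_wpM2l// -expRM_natl ler_expR.
  by rewrite -natr1; lra.
have -> : r F n.+1 m - r F n m = (sieve_poly F R m)`_n.+1.
  by rewrite rough_propS; ring.
rewrite sieve_poly_rec (@big_cat_nat _ _ _ m.+1)//= ?ltnS; last exact: leqW.
rewrite opprD; congr (_ - _); rewrite -opprB -(sum_sieve_coef F m mn); congr (- _).
by apply: eq_big_nat => j /andP[j0 jm]; rewrite log_deriv_coef_small ?mul1r ?j0.
Qed.

Definition err F m n : R :=
  r F n m - lambda F R m * expR (euler_gamma R) * w (n%:R / m%:R).

Lemma kappa_bounds F m : (0 < m)%N ->
  let k : R := lambda F R m * expR (euler_gamma R) in
  [/\ 0 < k, k <= m%:R^-1, expR (- 5) / m%:R <= k & `|1 - m%:R * k| <= 5 / m%:R].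
Proof.
move=> m0 k; have m0' : 0 < m%:R :> R by rewrite ltr0n.
have [d /andP[d0 d5] kE] := lambda_gamma F R m0.
have k0 : 0 < k by rewrite mulr_gt0 ?lambda_gt0 ?expR_gt0.
have kE' : m%:R * k = expR (- d) by rewrite mulrC kE.
split => //.
- by rewrite -[leRHS]mul1r ler_pdivlMr// kE expR_le1; lra.
- rewrite ler_pdivrMr// kE ler_expR lerN2 (le_trans d5)// ler_pdivrMr//.
  by rewrite ler_pMr// ler1n.
- rewrite kE' ger0_norm; last by rewrite subr_ge0 expR_le1; lra.
  by have := expR_ge1Dx (- d); lra.
Qed.

Lemma err_rec F m n : (0 < m)%N -> (m.*2 <= n)%N ->
  exists2 x : R, 0 <= x <= m%:R^-1 & exists2 s : R, `|s| <= sieve_tail m &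
  n.+1%:R * err F m n.+1 = n%:R * err F m n + (r F (n - m) m -
    lambda F R m * expR (euler_gamma R) * w ((n - m)%:R / m%:R + x)) - s.
Proof.
move=> m0 mn; have [x x01 wE] := buchstab_grid R m0 mn; exists x => //.
have mn' : (m <= n)%N by rewrite (leq_trans _ mn)// -addnn leq_addl.
have [s sb rE] := rough_prop_rec F mn'; exists s => //.
rewrite /err -wE; set k := lambda F R m * _.
have -> : n.+1%:R * (r F n.+1 m - k * w (n.+1%:R / m%:R)) =
  n.+1%:R * (r F n.+1 m - r F n m) + n.+1%:R * r F n m -
  k * (n.+1%:R * w (n.+1%:R / m%:R)) by ring.
rewrite rE; set a := w (n.+1%:R / m%:R).
have -> : n.+1%:R = n%:R + 1 :> R by rewrite natr1.
by ring.
Qed.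

Lemma sieve_tail_le (j : nat) : exists2 c : R, 0 < c &
  forall m, (0 < m)%N -> sieve_tail m <= c / m%:R ^+ j.+1.
Proof.
exists (10 * (j.+1)`!%:R * 4 ^+ j.+1).
  by rewrite !mulr_gt0 ?exprn_gt0// ltr0n fact_gt0.
move=> m m0; have m0' : 0 < m%:R :> R by rewrite ltr0n.
have f0 : 0 < (j.+1)`!%:R :> R by rewrite ltr0n fact_gt0.
rewrite /sieve_tail -!mulrA ler_wpM2l// expRN.
have -> : (j.+1)`!%:R * (4 ^+ j.+1 / m%:R ^+ j.+1) =
    ((m%:R / 4) ^+ j.+1 / (j.+1)`!%:R)^-1 :> R.
  rewrite expr_div_n; field.
  by rewrite !expf_neq0 ?gt_eqF.
have x0 : 0 <= m%:R / 4 :> R by rewrite divr_ge0.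
rewrite lef_pV2 ?posrE ?expR_gt0 ?divr_gt0 ?exprn_gt0 ?divr_gt0//.
by apply: le_trans (expR_ge1Dxn j x0); rewrite lerDr.
Qed.

Lemma err_first F m n : (0 < m)%N -> (m < n)%N -> (n <= m.*2.+1)%N ->
  `|n%:R * r F n m - 1| <= (n - m)%:R * sieve_tail m.
Proof.
move=> m0; elim: n => // n IH; rewrite ltnS => mn n2m.
have [s sb rE] := rough_prop_rec F mn.
have {}rE : n.+1%:R * r F n.+1 m = n%:R * r F n m + r F (n - m) m - s.
  have -> : n.+1%:R * r F n.+1 m = n.+1%:R * (r F n.+1 m - r F n m) + n.+1%:R * r F n m.
    by ring.
  have N1 : n.+1%:R = n%:R + 1 :> R by rewrite natr1.
  by rewrite rE N1; ring.
rewrite rE; have [mn'|] := ltnP m n; last first.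
  move=> nm; have -> : n = m by apply/eqP; rewrite eqn_leq nm mn.
  rewrite subnn rough_prop0 rough_prop_small ?m0 ?leqnn// mulr0 add0r subSnn mul1r.
  by rewrite addrAC subrr add0r normrN.
have -> : r F (n - m) m = 0.
  by rewrite rough_prop_small// subn_gt0 mn'/= leq_subLR addnn.
rewrite addr0 addrAC (le_trans (ler_normB _ _))// subSn// -natr1 mulrDl mul1r.
by rewrite lerD// IH// ltnW.
Qed.

Lemma err_le_expR : exists2 A : R, 0 < A &
  forall F m n, (0 < m)%N -> (m < n)%N ->
    `|n%:R * err F m n| <= A / m%:R * expR (n%:R / m%:R).
Proof.
have [c c0 tailc] := sieve_tail_le 1.
pose A := 4 * c + 8; exists A; first by rewrite /A; lra.
move=> F m n m0; have m0' : 0 < m%:R :> R by rewrite ltr0n.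
have m1' : 1 <= m%:R :> R by rewrite ler1n.
have i0 : 0 < m%:R^-1 :> R by rewrite invr_gt0.
have i1 : m%:R^-1 <= 1 :> R by rewrite invf_le1.
have [k0 ki _ k1] := kappa_bounds F m0.
set k : R := lambda F R m * expR (euler_gamma R) in k0 ki k1.
have tail2 : sieve_tail m <= c * m%:R^-1 * m%:R^-1.
  by rewrite -mulrA -invfM -expr2; exact: tailc.
have Ai : 0 < A / m%:R by rewrite mulr_gt0// /A; lra.
have start j : (m < j)%N -> (j <= m.*2)%N -> `|j%:R * err F m j| <= (2 * c + 5) / m%:R.
  move=> mj j2m; have j0' : 0 < j%:R :> R by rewrite ltr0n (ltn_trans m0).
  have wj : w (j%:R / m%:R) = m%:R / j%:R.
    rewrite buchstab_itv12 ?invf_div// ler_pdivlMr// mul1r ler_nat ltnW//=.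
    by rewrite ler_pdivrMr// -natrM ler_nat mul2n.
  have -> : j%:R * err F m j = (j%:R * r F j m - 1) + (1 - m%:R * k).
    by rewrite /err wj -/k; field; rewrite gt_eqF.
  apply: (le_trans (ler_normD _ _)); rewrite mulrDl lerD//.
  apply: (le_trans (err_first F m0 mj _)); first by rewrite leqW.
  have jm : (j - m)%:R <= m%:R :> R by rewrite ler_nat leq_subLR addnn.
  apply: (@le_trans _ _ (m%:R * (c * m%:R^-1 * m%:R^-1))).
    by rewrite ler_pM// ltW// sieve_tail_gt0.
  have -> : m%:R * (c * m%:R^-1 * m%:R^-1) = c / m%:R by field; rewrite gt_eqF.
  by rewrite ler_wpM2r ?(ltW i0)//; lra.
have big_step N (a b : R) : `|a| <= b -> `|a| <= b * expR (N%:R / m%:R).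
  move=> ab; apply: (le_trans ab); rewrite ler_peMr//.
    by rewrite (le_trans _ ab).
  by rewrite -expR0 ler_expR divr_ge0.
elim/ltn_ind: n => -[//|n] IH mn.
have [n2m|n2m] := leqP n.+1 m.*2.
  apply/big_step/(le_trans (start _ mn n2m)).
  by rewrite ler_wpM2r ?(ltW i0)// /A; lra.
rewrite ltnS in n2m.
have [x /andP[x0 xm] [s sb ->]] := err_rec F m0 n2m.
rewrite -/k; have sb' := le_trans sb tail2.
have m2n : (m <= n)%N by rewrite (leq_trans _ n2m)// -addnn leq_addl.
have nm1 : 1 <= (n - m)%:R / m%:R :> R.
  by rewrite ler_pdivlMr// mul1r ler_nat leq_subRL// addnn.
have cii : c * m%:R^-1 * m%:R^-1 <= c / m%:R by rewrite ler_piMr// mulr_ge0// ltW.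
have kw : `|k * w ((n - m)%:R / m%:R + x)| <= m%:R^-1.
  have := @buchstab_bounds R ((n - m)%:R / m%:R + x) ltac:(lra) => /andP[w1 w2].
  rewrite ger0_norm; last by rewrite mulr_ge0 ?(ltW k0)//; lra.
  by rewrite (le_trans _ ki)// ler_piMr// ltW.
move: n2m; rewrite leq_eqVlt => /orP[/eqP n2m|n2m].
  apply: big_step; rewrite -n2m -addnn addnK rough_prop_small ?m0 ?leqnn// sub0r.
  apply: (le_trans (ler_normB _ _)); apply: (le_trans (lerD (ler_normD _ _) sb')).
  rewrite normrN; have e1 := start m.*2; rewrite leqnn -addnn -{1}[m]addn0 ltn_add2l m0 in e1.
  have {}e1 := e1 isT isT; rewrite -n2m -addnn addnK in kw.
  apply: (le_trans (lerD (lerD e1 kw) cii)).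
  by rewrite -[X in _ + X + _]mul1r -!mulrDl ler_wpM2r ?(ltW i0)// /A; lra.
have mn' : (m < n)%N by rewrite (leq_ltn_trans _ n2m)// -addnn leq_addl.
have mnm : (m < n - m)%N by rewrite ltn_subRL addnn.
have en : `|n%:R * err F m n| <= A / m%:R * expR (n%:R / m%:R).
  exact: IH.
have enm : `|(n - m)%:R * err F m (n - m)| <= A / m%:R * expR ((n - m)%:R / m%:R).
  by apply: IH => //; rewrite ltnS leq_subr.
have nm0 : 0 < (n - m)%:R :> R by rewrite ltr0n (ltn_trans m0).
set E := expR (n%:R / m%:R) in en *.
have E1 : 1 <= E by rewrite -expR0 ler_expR divr_ge0.
have Em : expR ((n - m)%:R / m%:R) <= E / 2.
  have -> : (n - m)%:R / m%:R = n%:R / m%:R - 1 :> R.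
    by rewrite natrB// mulrBl divff// gt_eqF.
  rewrite expRD ler_wpM2l ?expR_ge0// expRN lef_pV2 ?posrE ?expR_gt0//.
  by have := expR_ge1Dx (1 : R).
have {}enm : `|err F m (n - m)| <= A / m%:R * (E / 2) / m%:R.
  have nmm : m%:R <= (n - m)%:R :> R by rewrite ler_nat ltnW.
  have : (n - m)%:R * `|err F m (n - m)| <= A / m%:R * (E / 2).
    rewrite -[X in X * _](ger0_norm (ltW nm0)) -normrM (le_trans enm)//.
    by rewrite ler_wpM2l ?(ltW Ai).
  rewrite ler_pdivlMr//; apply: le_trans.
  by rewrite mulrC ler_wpM2r.
have ES : E * (1 + m%:R^-1) <= expR (n.+1%:R / m%:R).
  rewrite -natr1 mulrDl mul1r expRD ler_wpM2l ?expR_ge0//.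
  exact: expR_ge1Dx.
have lip : `|k * (w ((n - m)%:R / m%:R) - w ((n - m)%:R / m%:R + x))| <= m%:R^-1 * m%:R^-1.
  rewrite normrM (gtr0_norm k0) distrC ler_pM ?(ltW k0)//.
  apply: (le_trans (buchstab_lip1 nm1 _)); first by rewrite lerDl.
  by rewrite addrAC subrr add0r.
have -> : n%:R * err F m n +
    (r F (n - m) m - k * w ((n - m)%:R / m%:R + x)) - s =
  n%:R * err F m n + err F m (n - m) +
    k * (w ((n - m)%:R / m%:R) - w ((n - m)%:R / m%:R + x)) - s.
  by rewrite [in X in _ + X + _ - _]/err -/k; ring.
apply: (le_trans (ler_normB _ _)); apply: (le_trans (lerD (ler_normD _ _) (lexx _))).
apply: (le_trans (lerD (lerD (ler_normD _ _) (lexx _)) (lexx _))).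
apply: (le_trans (lerD (lerD (lerD en enm) lip) sb')).
apply: (@le_trans _ _ (A / m%:R * (E * (1 + m%:R^-1)))); last by rewrite ler_wpM2l ?(ltW Ai).
have -> : A / m%:R * E + A / m%:R * (E / 2) / m%:R + m%:R^-1 / m%:R + c / m%:R / m%:R =
  A / m%:R * E + (A * E / 2 + 1 + c) * (m%:R^-1 * m%:R^-1) by field; rewrite gt_eqF.
have -> : A / m%:R * (E * (1 + m%:R^-1)) = A / m%:R * E + (A * E) * (m%:R^-1 * m%:R^-1).
  by field; rewrite gt_eqF.
rewrite lerD2l ler_wpM2r//.
have A2 : 1 + c <= A / 2 by rewrite /A; lra.
have AE : A <= A * E by rewrite ler_peMr// /A; lra.
clearbody A; lra.
Qed.

End recursion.

Section buchstab_limit.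
Variable R : realType.
Notation w := (@buchstab R).
Notation gamma := (euler_gamma R).
Notation G := (weight (4^-1 : R)).

Lemma expR2_le16 : expR 2 <= 16 :> R.
Proof.
have -> : 2 = 8%:R * 4^-1 :> R by field.
rewrite expRM_natl (@le_trans _ _ ((4 / 3) ^+ 8))//.
  by rewrite lerXn2r ?nnegrE ?expR_ge0 ?expR_fourth//; lra.
by rewrite !exprS expr0; lra.
Qed.

(* The scale [m = 16 ^ k] is large enough for [err F m (k * m)] to be negligible
   and small enough for Rankin's bound to be so too. *)
Lemma buchstab_limit_nat : exists2 C : R, 0 < C &
  exists k0 : nat, forall k, (k0 <= k)%N ->
    `|w k%:R - expR (- gamma)| <= C * expR (- k%:R).
Proof.
have [A A0 errA] := @err_le_expR R.
pose C : R := expR 5 * (expR 2 + A).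
have e50 : 0 < expR 5 :> R := expR_gt0 _.
exists C; first by rewrite mulr_gt0// addr_gt0 ?expR_gt0.
pose b : R := ln 256 + 2.
exists (Num.truncn `|expR b|).+2 => k kk.
have k2 : (1 < k)%N by exact: leq_trans kk.
have k0 : 0 < k%:R :> R by rewrite ltr0n (ltn_trans _ k2).
have k1 : 1 <= k%:R :> R by rewrite ler1n (ltn_trans _ k2).
have lnk : b <= ln k%:R.
  rewrite -ler_expR lnK ?posrE// (le_trans (ler_norm _))// ltW//.
  by rewrite (lt_le_trans (truncnS_gt _))// ler_nat (leq_trans _ kk)// ltnW.
pose m := (16 ^ k)%N; pose n := (k * m)%N.
have m0 : (0 < m)%N by rewrite expn_gt0.
have mn : (m < n)%N by rewrite /n -{1}[m]mul1n ltn_pmul2r.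
have m0' : 0 < m%:R :> R by rewrite ltr0n.
have um : n%:R / m%:R = k%:R :> R by rewrite /n natrM mulfK// gt_eqF.
pose F : finFieldType := 'F_2.
have h1 := errA F m n m0 mn.
have h2 := rough_prop_sub_lambda_le F R m0 (ltnW mn).
have [ka0 _ kl _] := kappa_bounds R F m0.
rewrite um in h1 h2.
have errE : err R F m n = rough_prop F R n m -
    lambda F R m * expR gamma * w k%:R by rewrite /err um.
have lE : lambda F R m = lambda F R m * expR gamma * expR (- gamma).
  by rewrite -mulrA -expRD subrr expR0 mulr1.
set ka : R := lambda F R m * expR gamma in ka0 kl errE lE.
have h3 : `|ka * (w k%:R - expR (- gamma))| <=
    `|rough_prop F R n m - lambda F R m| + `|err R F m n|.
  have -> : ka * (w k%:R - expR (- gamma)) =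
    (rough_prop F R n m - lambda F R m) - err R F m n.
    by rewrite errE [in RHS]lE; ring.
  exact: ler_normB.
have mE : m%:R = 16 ^+ k :> R by rewrite natrX.
have mexp : m%:R = expR (k%:R * ln 16) :> R by rewrite expRM_natl lnK ?posrE.
have e1 : `|err R F m n| * m%:R <= A * expR (- k%:R).
  have : m%:R * `|err R F m n| <= A / m%:R * expR k%:R.
    apply: le_trans h1; rewrite normrM ler_wpM2r// ger0_norm// ler_nat.
    exact: ltnW.
  rewrite mulrC => /le_trans; apply; rewrite -mulrA ler_wpM2l ?(ltW A0)//.
  rewrite ler_pdivrMl// -ler_pdivrMr ?expR_gt0// expRN invrK mE -expRD.
  have -> : k%:R + k%:R = k%:R * 2 :> R by ring.
  by rewrite expRM_natl lerXn2r ?nnegrE ?expR_ge0 ?expR2_le16.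
have e2 : `|rough_prop F R n m - lambda F R m| * m%:R <= expR 2 * expR (- k%:R).
  apply: (le_trans (ler_wpM2r (ltW m0') h2)).
  have assoc (x y z : R) : x * y * z * y = x * (y * y * z) by ring.
  rewrite assoc ler_wpM2l ?expR_ge0// mexp -!expRD ler_expR.
  have l256 : ln 256 = ln 16 + ln 16 :> R.
    by rewrite -lnM ?posrE//; congr ln; rewrite -natrM.
  have := ler_wpM2l (ltW k0) lnk; rewrite /b l256.
  by move: (k%:R : R) (ln (16 : R)) (ln _) => z x y; lra.
have h4 : ka * m%:R * `|w k%:R - expR (- gamma)| <= (expR 2 + A) * expR (- k%:R).
  have -> : ka * m%:R * `|w k%:R - expR (- gamma)| =
    `|ka * (w k%:R - expR (- gamma))| * m%:R by rewrite normrM (gtr0_norm ka0); ring.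
  rewrite (le_trans (ler_wpM2r (ltW m0') h3))// mulrDl [leRHS]mulrDl.
  exact: lerD.
have {}kl : expR (- 5) <= ka * m%:R by rewrite -ler_pdivrMr.
rewrite /C -mulrA -ler_pdivrMl// -expRN.
by apply: le_trans h4; rewrite ler_wpM2r.
Qed.

Lemma buchstab_limit : exists2 K : R, 0 < K & forall u, 1 <= u ->
  `|w u - expR (- gamma)| <= K * G u.
Proof.
have [K K0 HK] := @buchstab_sub_le R.
have [C C0 [k0 HC]] := buchstab_limit_nat.
have G16 : 0 < G 16 := weight_gt0 _ _.
have gb : 0 <= expR (- gamma) <= 1.
  by rewrite expR_ge0 expR_le1 oppr_le0; have /andP[] := euler_gamma_bounds R.
exists (K + (G 16)^-1); first by rewrite addr_gt0 ?invr_gt0.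
move=> u u1; have Gu : 0 < G u := weight_gt0 _ _.
have [u16|u16] := leP 16 u; last first.
  have /andP[w0 w1] := buchstab_bounds u1; case/andP: gb => g0 g1.
  apply: (@le_trans _ _ 1); first by rewrite ler_norml; apply/andP; split; lra.
  rewrite mulrDl (@le_trans _ _ ((G 16)^-1 * G u))//; last first.
    by rewrite lerDr mulr_ge0 ?ltW.
  rewrite mulrC ler_pdivlMr// mul1r.
  by apply: weight_le; [rewrite invr_ge0|exact: u1|exact: ltW].
apply: (@le_trans _ _ (K * G u)); last by rewrite ler_wpM2r ?(ltW Gu)// lerDl invr_ge0 ltW.
apply/ler_addgt0Pr => e e0.
pose k := (k0 + (Num.truncn `|u|).+1 + (Num.truncn `|C / e|).+1)%N.
have uk : u <= k%:R.
  rewrite (le_trans (ler_norm u))// ltW// (lt_le_trans (truncnS_gt `|u|))//.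
  by rewrite ler_nat /k -addnA addnCA leq_addr.
have Ck : C / e <= k%:R.
  rewrite (le_trans (ler_norm _))// ltW// (lt_le_trans (truncnS_gt _))//.
  by rewrite ler_nat /k leq_addl.
have h1 := HK u k%:R u16 uk.
have h2 : `|w k%:R - expR (- gamma)| <= e.
  apply: (le_trans (HC k _)); first by rewrite /k -addnA leq_addr.
  have k0' : 0 < k%:R :> R by lra.
  apply: (@le_trans _ _ (C / k%:R)); last first.
    by rewrite ler_pdivrMr// mulrC -ler_pdivrMr.
  rewrite ler_wpM2l ?(ltW C0)// expRN lef_pV2 ?posrE ?expR_gt0//.
  by have := expR_ge1Dx (k%:R : R); lra.
apply: (le_trans (ler_distD (w k%:R) _ _)); rewrite lerD//.
by rewrite distrC.
Qed.

End buchstab_limit.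

(** * Decay of the error term *)

Section error.
Variable R : realType.
Implicit Types (F : finFieldType) (m n : nat).
Notation w := (@buchstab R).
Notation r F n m := (rough_prop F R n m).
Notation gamma := (euler_gamma R).
Notation g := (weight (0 : R)).
Notation G := (weight (4^-1 : R)).

Let g_gt0 u : 0 < g u. Proof. exact: weight_gt0. Qed.

Let g_le (x y : R) : 1 <= x -> x <= y -> g y <= g x.
Proof. exact: weight_le. Qed.

Let G_le_g (u : R) : 0 <= u -> G u <= g u.
Proof. by move=> u0; rewrite ler_expR; lra. Qed.

Lemma sieve_tail_le_weight : exists2 C : R, 0 < C & forall m (u : R), (0 < m)%N ->
  1 <= u -> expR (u / 5) <= m%:R ^+ 3 -> sieve_tail R m <= C * g u / m%:R ^+ 2.
Proof.
have [T T0 TE] : exists2 T : R, 0 < T & T = 60 ^+ 3 by exists (60 ^+ 3).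
pose D : R := T ^+ 2.
exists (10 * (128 * expR D)); first by rewrite !mulr_gt0 ?expR_gt0.
move=> m u m0 u1 um; have m0' : 0 < m%:R :> R by rewrite ltr0n.
have u0 : 0 < u by lra.
have mu : expR (u / 15) <= m%:R.
  rewrite -(@ler_pXn2r _ 3)// ?nnegrE ?expR_ge0// -expRM_natl.
  by have -> : 3%:R * (u / 15) = u / 5 :> R by field.
have m3 : (u / 15) ^+ 3 / 6 <= m%:R.
  have x0 : 0 <= u / 15 by lra.
  apply: le_trans mu; apply: le_trans (expR_ge1Dxn 2 x0).
  by rewrite (_ : 3`! = 6%N)// lerDr.
have h1 : expR (- (m%:R / 8)) <= 128 / m%:R ^+ 2 :> R.
  have x0 : 0 <= m%:R / 8 :> R by rewrite divr_ge0.
  have := expR_ge1Dxn 1 x0; rewrite (_ : 2`! = 2%N)// => h.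
  have -> : (128 : R) / m%:R ^+ 2 = ((m%:R / 8) ^+ 2 / 2)^-1 by field; rewrite gt_eqF.
  rewrite expRN lef_pV2 ?posrE ?expR_gt0 ?divr_gt0 ?exprn_gt0 ?divr_gt0//.
  by apply: le_trans h; rewrite lerDr.
have h2 : expR (- (m%:R / 8)) <= expR D * g u.
  rewrite -expRD ler_expR subr0 mul1r.
  have lnu : u * ln u <= u * u by rewrite ler_wpM2l ?(ltW u0)// ltW// ln_sublinear.
  have uD : u * u <= (u / 15) ^+ 3 / 6 / 8 + D.
    have -> : (u / 15) ^+ 3 / 6 / 8 = 4 / 3 * (u * u * (u / T)) by rewrite TE; field.
    have c0 : 0 <= u * u * (u / T) by rewrite !mulr_ge0 ?(ltW u0) ?invr_ge0 ?(ltW T0).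
    rewrite /D expr2; have [u2|u2] := leP u T.
      have : u * u <= T * T by rewrite ler_pM ?(ltW u0).
      by move: c0; clear; lra.
    have : u * u <= u * u * (u / T).
      by rewrite ler_peMr ?mulr_ge0 ?(ltW u0)// ler_pdivlMr// mul1r ltW.
    have : 0 <= T * T by rewrite mulr_ge0 ?(ltW T0).
    by move: c0; clear; lra.
  by move: (u * ln u) (u * u) lnu uD => x y lnu uD; clearbody D; lra.
have -> : sieve_tail R m = 10 * (expR (- (m%:R / 8)) * expR (- (m%:R / 8))).
  by rewrite /sieve_tail -expRD; congr (_ * expR _); field.
have -> : 10 * (128 * expR D) * g u / m%:R ^+ 2 =
  10 * ((128 / m%:R ^+ 2) * (expR D * g u)) by field; rewrite gt_eqF.
by rewrite ler_wpM2l// ler_pM ?expR_ge0.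
Qed.

Lemma err_diff_rec F m n : (0 < m)%N -> (m.*2 < n)%N ->
  exists2 x : R, 0 <= x <= m%:R^-1 & exists2 s : R, `|s| <= sieve_tail R m &
  n.+1%:R * (err R F m n.+1 - err R F m n) =
  err R F m (n - m) - err R F m n +
  lambda F R m * expR gamma *
    (w ((n - m)%:R / m%:R) - w ((n - m)%:R / m%:R + x)) - s.
Proof.
move=> m0 mn; have [x x01 [s sb E]] := err_rec R F m0 (ltnW mn).
exists x => //; exists s => //; rewrite mulrBr E /err.
set a := w (n%:R / m%:R).
have -> : n.+1%:R = n%:R + 1 :> R by rewrite natr1.
by ring.
Qed.

Lemma telescope_norm (f : nat -> R) (a b : nat) (c : R) : (a <= b)%N ->
  (forall i, (a <= i < b)%N -> `|f i.+1 - f i| <= c) ->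
  `|f b - f a| <= (b - a)%:R * c.
Proof.
elim: b => [|b IH]; first by rewrite leqn0 => /eqP -> _; rewrite subrr normr0 mul0r.
rewrite leq_eqVlt => /predU1P[<- _|]; first by rewrite subrr normr0 subnn mul0r.
rewrite ltnS => ab H; rewrite subSn// -natr1 mulrDl mul1r [leRHS]addrC.
apply: (le_trans (ler_distD (f b) _ _)); rewrite lerD//; first by apply: H; rewrite ab/=.
by apply: IH => // i /andP[ai ib]; apply: H; rewrite ai ltnS ltnW.
Qed.

Lemma err_diff_le : exists2 B : R, 0 < B & forall F m n, (10 <= m)%N ->
  (15 * m <= n)%N -> expR (n%:R / m%:R / 5) <= m%:R ^+ 3 :> R ->
  `|err R F m n.+1 - err R F m n| <= B / m%:R ^+ 3 * g (n%:R / m%:R).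
Proof.
have [A A0 errA] := @err_le_expR R.
have [c c0 tailc] := sieve_tail_le R 1.
have [K K0 lipK] := @buchstab_lip R.
have [C C0 tailC] := sieve_tail_le_weight.
pose B0 : R := 2 * A * expR 16 + 1 + c.
have B00 : 0 < B0 by rewrite !addr_gt0 ?mulr_gt0 ?expR_gt0.
pose B : R := B0 / g 16 + 4 * (C + K).
have Bb : B0 / g 16 <= B by rewrite /B lerDl; lra.
have Bs : C + K <= B / 4.
  have : 0 < B0 / g 16 by rewrite divr_gt0.
  by rewrite /B; move: (B0 / _) => z; lra.
have B0' : 0 < B by rewrite (lt_le_trans _ Bb)// divr_gt0.
exists B => // F m n m10; clearbody B.
have m0 : (0 < m)%N by exact: leq_trans m10.
have m0' : 0 < m%:R :> R by rewrite ltr0n.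
have i0 : 0 < m%:R^-1 :> R by rewrite invr_gt0.
have [k0 ki _ _] := kappa_bounds R F m0.
set k : R := lambda F R m * expR gamma in k0 ki.
elim/ltn_ind: n => n IH mn small.
have m2n : (m.*2 < n)%N.
  by rewrite (leq_trans _ mn)// -muln2 mulnC ltn_pmul2r.
have mn1 : (m < n)%N by rewrite (leq_ltn_trans _ m2n)// -addnn leq_addl.
have mnm : (m < n - m)%N by rewrite ltn_subRL addnn.
have [x /andP[x0 xm] [s sb recE]] := err_diff_rec F m0 m2n; rewrite -/k in recE.
set u : R := n%:R / m%:R in small *.
have uE : (n - m)%:R / m%:R = u - 1 :> R.
  by rewrite natrB ?(ltnW mn1)// mulrBl divff// gt_eqF.
have u15 : 15 <= u by rewrite ler_pdivlMr// -natrM ler_nat.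
have [u0 u1 u1' u11] : [/\ 0 <= u, 1 <= u, 1 < u & 1 <= u - 1].
  by clear -u15; split; lra.
have ux : u - 1 <= u - 1 + x by rewrite lerDl.
have nE : n%:R = u * m%:R by rewrite divfK// gt_eqF.
have n1 : m%:R <= n.+1%:R :> R by rewrite ler_nat ltnW// ltnS ltnW.
have n0 : 0 < n.+1%:R :> R by rewrite ltr0n.
rewrite uE in recE.
have lip : `|k * (w (u - 1) - w (u - 1 + x))| <= m%:R^-1 * (K * G (u - 1) * m%:R^-1).
  rewrite normrM (gtr0_norm k0) distrC ler_pM ?(ltW k0)//.
  apply: (le_trans (lipK _ _ u11 ux)).
  rewrite addrAC subrr add0r ler_wpM2l// mulr_ge0 ?(ltW K0)//.
  exact/ltW/weight_gt0.
have [n16|n16] := ltnP n (16 * m).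
  have u16 : u <= 16 by rewrite ler_pdivrMr// -natrM ler_nat ltnW.
  have errm j : (m < j)%N -> (j <= n)%N -> `|err R F m j| <= A * expR 16 * (m%:R^-1 * m%:R^-1).
    move=> mj jn; have jm : m%:R <= j%:R :> R by rewrite ler_nat ltnW.
    have : m%:R * `|err R F m j| <= A / m%:R * expR 16.
      apply: (@le_trans _ _ `|j%:R * err R F m j|); first by rewrite normrM ler_wpM2r// ger0_norm.
      apply: (le_trans (errA F m j m0 mj)); rewrite ler_wpM2l ?mulr_ge0 ?(ltW A0) ?(ltW i0)//.
      rewrite ler_expR; apply: le_trans u16.
      by rewrite ler_wpM2r ?(ltW i0)// ler_nat.
    rewrite -ler_pdivlMl// => /le_trans; apply; rewrite le_eqVlt; apply/orP; left.
    by apply/eqP; ring.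
  have lip' : `|k * (w (u - 1) - w (u - 1 + x))| <= 1 * (m%:R^-1 * m%:R^-1).
    rewrite mul1r normrM (gtr0_norm k0) distrC ler_pM ?(ltW k0)//.
    apply: (le_trans (buchstab_lip1 u11 ux)).
    by rewrite addrAC subrr add0r.
  have sb' : `|s| <= c * (m%:R^-1 * m%:R^-1).
    by apply: (le_trans sb); apply: (le_trans (tailc m m0)); rewrite expr2 invfM.
  have main : `|n.+1%:R * (err R F m n.+1 - err R F m n)| <= B0 * (m%:R^-1 * m%:R^-1).
    rewrite recE; apply: (le_trans (ler_normB _ _)).
    apply: (le_trans (lerD (ler_normD _ _) sb')).
    apply: (le_trans (lerD (lerD (ler_normB _ _) lip') (lexx _))).
    have e1 := errm (n - m)%N mnm (leq_subr _ _).
    have e2 := errm n mn1 (leqnn n).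
    apply: (le_trans (lerD (lerD (lerD e1 e2) (lexx _)) (lexx _))).
    by rewrite -!mulrDl ler_wpM2r ?mulr_ge0 ?(ltW i0)// /B0; lra.
  apply: (@le_trans _ _ (B0 / m%:R ^+ 3)).
    move: main; rewrite normrM (gtr0_norm n0) -ler_pdivlMl// => /le_trans; apply.
    apply: (@le_trans _ _ (m%:R^-1 * (B0 * (m%:R^-1 * m%:R^-1)))).
      rewrite ler_wpM2r ?mulr_ge0 ?(ltW B00) ?(ltW i0)// lef_pV2 ?posrE//.
    by rewrite le_eqVlt; apply/orP; left; apply/eqP; field; rewrite gt_eqF.
  rewrite -mulrA [X in _ <= _ * X]mulrC mulrA ler_wpM2r ?invr_ge0 ?exprn_ge0//.
  apply: (@le_trans _ _ (B0 / g 16 * g u)).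
    rewrite -mulrA -{1}[B0]mulr1 ler_wpM2l ?(ltW B00)// ler_pdivlMl// mulr1.
    exact: g_le.
  by rewrite ler_wpM2r// ltW.
have u16 : 16 <= u by rewrite ler_pdivlMr// -natrM ler_nat.
have step i : (n - m <= i)%N -> (i < n)%N ->
    `|err R F m i.+1 - err R F m i| <= B / m%:R ^+ 3 * g (i%:R / m%:R).
  move=> mi ilt; apply: IH => //.
    by rewrite (leq_trans _ mi)// leq_subRL ?(ltnW mn1)// -mulSn.
  apply: le_trans small; rewrite ler_expR ler_wpM2r// ler_wpM2r ?(ltW i0)//.
  by rewrite ler_nat ltnW.
pose h := (n - m./2)%N.
have hm : (m./2 <= m)%N by rewrite -{2}(odd_double_half m) -addnn addnA leq_addl.
have hn : (h <= n)%N by rewrite leq_subr.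
have nmh : (n - m <= h)%N by rewrite leq_sub2l.
have m2r := natr_half_le R m.
have m2r' : (h - (n - m))%:R <= (m%:R + 1) / 2 :> R.
  have -> : (h - (n - m) = m - m./2)%N.
    rewrite /h -subnDA addnC subnDA subKn//; exact: ltnW.
  exact: natr_sub_half_le.
have BM : 0 < B / m%:R ^+ 3 by rewrite divr_gt0// exprn_gt0.
have t1 : `|err R F m h - err R F m (n - m)| <=
    (m%:R + 1) / 2 * (B / m%:R ^+ 3 * (u * g u)).
  apply: (@le_trans _ _ ((h - (n - m))%:R * (B / m%:R ^+ 3 * (u * g u)))); last first.
    rewrite ler_wpM2r// !mulr_ge0 ?(ltW B0') ?invr_ge0 ?exprn_ge0 ?(ltW (g_gt0 _))//.
  apply: telescope_norm => // i /andP[ni ih].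
  apply: (le_trans (step i ni (leq_trans ih hn))); rewrite ler_wpM2l ?(ltW BM)//.
  apply: (@le_trans _ _ (g (u - 1))); last exact: weight0_sub1.
  by apply: g_le => //; rewrite -uE ler_wpM2r ?(ltW i0)// ler_nat.
have t2 : `|err R F m n - err R F m h| <= m%:R / 2 * (B / m%:R ^+ 3 * (2 / 7 * u * g u)).
  apply: (@le_trans _ _ ((n - h)%:R * (B / m%:R ^+ 3 * (2 / 7 * u * g u)))); last first.
    rewrite ler_wpM2r ?subKn ?(leq_trans hm) ?(ltnW mn1)//.
    by rewrite !mulr_ge0 ?(ltW B0') ?invr_ge0 ?exprn_ge0 ?(ltW (g_gt0 _))//.
  apply: telescope_norm => // i /andP[hi ih].
  apply: (le_trans (step i (leq_trans nmh hi) ih)); rewrite ler_wpM2l ?(ltW BM)//.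
  apply: (@le_trans _ _ (g (u - 2^-1))); last by apply: weight_subhalf.
  apply: g_le; first by clear -u15; lra.
  rewrite ler_pdivlMr// mulrBl -nE.
  have : n%:R - (m./2)%:R <= i%:R :> R.
    by rewrite lerBlDr -natrD ler_nat addnC -leq_subLR.
  by move: m2r; clear; move: (i%:R : R) => y; lra.
have s' : `|s| <= C * g u / m%:R ^+ 2.
  exact: le_trans sb (tailC _ _ m0 u1 small).
have l' : `|k * (w (u - 1) - w (u - 1 + x))| <= K * (u * g u) / m%:R ^+ 2.
  apply: (le_trans lip).
  have -> : K * (u * g u) / m%:R ^+ 2 = m%:R^-1 * (K * (u * g u) * m%:R^-1).
    by field; rewrite gt_eqF.
  rewrite ler_wpM2l ?(ltW i0)// ler_wpM2r ?(ltW i0)// ler_wpM2l ?(ltW K0)//.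
  apply: (le_trans (G_le_g (le_trans ler01 u11))).
  exact: weight0_sub1.
have ugu : g u <= u * g u by rewrite ler_peMl ?(ltW (g_gt0 _)).
have {recE} : `|n.+1%:R * (err R F m n.+1 - err R F m n)| <=
    n%:R * (B / m%:R ^+ 3 * g u).
  have -> : n.+1%:R * (err R F m n.+1 - err R F m n) =
    - (err R F m n - err R F m h) - (err R F m h - err R F m (n - m)) +
    k * (w (u - 1) - w (u - 1 + x)) - s by rewrite recE; ring.
  apply: (le_trans (ler_normB _ _)).
  apply: (le_trans (lerD (ler_normD _ _) s')).
  apply: (le_trans (lerD (lerD (ler_normB _ _) l') (lexx _))).
  rewrite normrN; apply: (le_trans (lerD (lerD (lerD t2 t1) (lexx _)) (lexx _))).
  rewrite nE.
  have m10' : 10 <= m%:R :> R by rewrite ler_nat.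
  set M := m%:R in m0' m10' *; set P := u * g u in ugu *.
  have P0 : 0 < P by apply: lt_le_trans ugu.
  have -> : u * M * (B / M ^+ 3 * g u) = (B * P) / M ^+ 2.
    by rewrite /P; field; rewrite gt_eqF.
  have -> : M / 2 * (B / M ^+ 3 * (2 / 7 * u * g u)) +
     (M + 1) / 2 * (B / M ^+ 3 * P) + K * P / M ^+ 2 + C * g u / M ^+ 2 =
     (B * P / 7 + (1 + M^-1) / 2 * (B * P) + K * P + C * g u) / M ^+ 2.
    by rewrite /P; field; rewrite gt_eqF.
  rewrite ler_wpM2r ?invr_ge0 ?exprn_ge0 ?(ltW m0')//.
  have Mi : M^-1 <= 10^-1 by rewrite lef_pV2 ?posrE.
  have BP : 0 < B * P by rewrite mulr_gt0.
  have : M^-1 * (B * P) <= 10^-1 * (B * P) by rewrite ler_wpM2r ?(ltW BP).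
  have : C * g u <= C * P by rewrite ler_wpM2l ?(ltW C0).
  have : (C + K) * P <= B / 4 * P by rewrite ler_wpM2r ?(ltW P0).
  move: BP; clear; clearbody P; move: (M^-1) (g u) => y z.
  rewrite [(C + K) * P]mulrDl [B / 4 * P]mulrAC [(1 + y) / 2 * _]mulrAC mulrDl mul1r.
  move: (B * P) (C * z) (C * P) (K * P) => b1 b2 b3 b4.
  move: (y * b1) => b5; lra.
rewrite normrM (gtr0_norm n0) -ler_pdivlMl// => /le_trans; apply.
rewrite [leLHS]mulrA ler_piMl//; first exact: mulr_ge0 (ltW BM) (ltW (g_gt0 _)).
by rewrite mulrC ler_pdivrMr// mul1r ler_nat.
Qed.

Lemma err_sub_limit F m n : (0 < m)%N ->
  `|err R F m n| <= `|r F n m - lambda F R m| +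
    m%:R^-1 * `|w (n%:R / m%:R) - expR (- gamma)|.
Proof.
move=> m0; have [k0 ki _ _] := kappa_bounds R F m0.
have lE : lambda F R m = lambda F R m * expR gamma * expR (- gamma).
  by rewrite -mulrA -expRD subrr expR0 mulr1.
rewrite /err; set k : R := lambda F R m * expR gamma in k0 ki lE *.
have -> : r F n m - k * w (n%:R / m%:R) =
  (r F n m - lambda F R m) - k * (w (n%:R / m%:R) - expR (- gamma)).
  by rewrite [in RHS]lE; ring.
by apply: (le_trans (ler_normB _ _)); rewrite lerD2l normrM (gtr0_norm k0) ler_wpM2r.
Qed.

Lemma err_le_large : exists2 C : R, 0 < C & forall F m n, (10 <= m)%N ->
  (16 * m <= n)%N -> m%:R ^+ 3 <= expR (n%:R / m%:R / 5) :> R ->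
  `|err R F m n| <= C / m%:R ^+ 2 * g (n%:R / m%:R).
Proof.
have [K K0 HK] := buchstab_limit R.
exists (expR 2 + K); first by rewrite addr_gt0 ?expR_gt0.
move=> F m n m10 mn big; have m0 : (0 < m)%N by exact: leq_trans m10.
have m0' : 0 < m%:R :> R by rewrite ltr0n.
have m1' : 1 <= m%:R :> R by rewrite ler1n.
have mn' : (m <= n)%N by rewrite (leq_trans _ mn)// leq_pmull.
apply: (le_trans (err_sub_limit F n m0)).
set u : R := n%:R / m%:R in big *.
have u16 : 16 <= u by rewrite ler_pdivlMr// -natrM ler_nat.
have big' : expR (- (u / 5)) <= m%:R ^- 3.
  by rewrite expRN lef_pV2 ?posrE ?expR_gt0 ?exprn_gt0.
rewrite -mulrA mulrDl; apply: lerD.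
  apply: (le_trans (rough_prop_sub_lambda_le_gain F m0 mn' m10 u16)); rewrite -/u.
  have -> : expR (4 / 5 * u - u * ln u) = g u * expR (- (u / 5)).
    by rewrite -expRD; congr expR; field.
  have -> : expR 2 * (m%:R ^- 2 * g u) = expR 2 * m%:R * (g u * m%:R ^- 3).
    by field; rewrite gt_eqF.
  rewrite ler_wpM2l ?mulr_ge0 ?expR_ge0// ler_wpM2l// ltW//.
have -> : K * (m%:R ^- 2 * g u) = m%:R^-1 * (K * (g u * m%:R^-1)).
  by field; rewrite gt_eqF.
rewrite ler_wpM2l ?invr_ge0// (le_trans (HK u _))//; first by lra.
rewrite ler_wpM2l ?(ltW K0)//.
have -> : G u = g u * expR (- (u / 4)) by rewrite -expRD; congr expR; field.
rewrite ler_wpM2l ?(ltW (g_gt0 _))//.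
apply: (@le_trans _ _ (expR (- (u / 5)))); first by rewrite ler_expR; lra.
apply: (le_trans big'); rewrite lef_pV2 ?posrE ?exprn_gt0//.
by rewrite exprS ler_peMr ?(ltW m0')// expr_ge1// ltW.
Qed.

Lemma err_le_medium : exists2 C : R, 0 < C & forall F m n, (10 <= m)%N ->
  (16 * m <= n)%N -> `|err R F m n| <= C / m%:R ^+ 2 * g (n%:R / m%:R).
Proof.
have [C1 C10 large] := err_le_large; have [B B0 diff] := err_diff_le.
pose C : R := C1 + 2 * B; have C0 : 0 < C by rewrite addr_gt0 ?mulr_gt0.
exists C => // F m n m10.
have m0 : (0 < m)%N by exact: leq_trans m10.
have m0' : 0 < m%:R :> R by rewrite ltr0n.
have i0 : 0 < m%:R^-1 :> R by rewrite invr_gt0.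
have i1 : m%:R^-1 <= 1 :> R by rewrite invf_le1// ler1n.
pose N := ((Num.truncn `|(5 * m%:R ^+ 3)%R : R|).+1 * m)%N.
have [j] : exists j, (N <= n + j)%N by exists N; rewrite leq_addl.
elim: j n => [|j IH] n Nn mn; have [big|small] := leP (m%:R ^+ 3 : R) (expR (n%:R / m%:R / 5)).
- apply: (le_trans (large F m n m10 mn big)); rewrite ler_wpM2r ?(ltW (g_gt0 _))//.
  by rewrite ler_wpM2r ?invr_ge0 ?exprn_ge0// /C lerDl mulr_ge0// ltW.
- exfalso; move: small; apply/negP; rewrite -leNgt.
  apply: le_trans (expR_ge1Dx _); rewrite -[leLHS]add0r lerD// ler_pdivlMr//.
  rewrite ler_pdivlMr// mulrC; rewrite addn0 in Nn.
  have : N%:R <= n%:R :> R by rewrite ler_nat.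
  apply: le_trans; rewrite /N natrM mulrC ler_wpM2r// mulrC.
  by rewrite (le_trans (ler_norm _))// ltW// truncnS_gt.
- apply: (le_trans (large F m n m10 mn big)); rewrite ler_wpM2r ?(ltW (g_gt0 _))//.
  by rewrite ler_wpM2r ?invr_ge0 ?exprn_ge0// /C lerDl mulr_ge0// ltW.
have h1 := IH n.+1; rewrite addSnnS in h1; have {}h1 := h1 Nn (leqW mn).
have h2 := diff F m n m10 _ (ltW small).
have {}h2 := h2 (leq_trans (leq_mul (_ : 15 <= 16)%N (leqnn m)) mn).
have {}h2 := h2 isT.
set u : R := n%:R / m%:R in h2 *.
have u16 : 16 <= u by rewrite ler_pdivlMr// -natrM ler_nat.
have u1E : n.+1%:R / m%:R = u + m%:R^-1 :> R by rewrite -natr1 mulrDl mul1r.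
rewrite u1E in h1.
have gd : g (u + m%:R^-1) <= g u * (1 - m%:R^-1 / 2).
  have ud : 1 <= u by lra.
  apply: (le_trans (weight_add_le (lexx 0) ud (ltW i0))).
  rewrite ler_wpM2l ?(ltW (g_gt0 _))//.
  have lu : 1 <= ln u.
    rewrite -ler_expR lnK ?posrE; last by lra.
    apply: le_trans u16; apply: le_trans (expR2_le16 R).
    by rewrite ler_expR; lra.
  apply: (@le_trans _ _ (expR (- m%:R^-1))); first by rewrite ler_expR lerN2 ler_peMr ?(ltW i0).
  have e1 := expR_ge1Dx (m%:R^-1 : R); rewrite expRN.
  apply: (@le_trans _ _ (1 + m%:R^-1)^-1).
    by rewrite lef_pV2 ?posrE ?expR_gt0//; lra.
  by move: (m%:R^-1 : R) i0 i1 => y y0 y1; rewrite -[leLHS]mul1r ler_pdivrMr; nra.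
have -> : err R F m n = err R F m n.+1 - (err R F m n.+1 - err R F m n) by ring.
apply: (le_trans (ler_normB _ _)); apply: (le_trans (lerD h1 h2)).
have CM : 0 < C / m%:R ^+ 2 by rewrite divr_gt0// exprn_gt0.
apply: (le_trans (lerD (ler_wpM2l (ltW CM) gd) (lexx _))).
have -> : C / m%:R ^+ 2 * (g u * (1 - m%:R^-1 / 2)) + B / m%:R ^+ 3 * g u =
  C / m%:R ^+ 2 * g u - (C / 2 - B) * (m%:R ^- 3 * g u) by field; rewrite gt_eqF.
rewrite gerBl mulr_ge0//; first by rewrite /C; lra.
by rewrite mulr_ge0 ?invr_ge0 ?exprn_ge0 ?(ltW (g_gt0 _)).
Qed.

Lemma err_le : exists2 C : R, 0 < C & forall F m n, (0 < m)%N -> (m < n)%N ->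
  `|err R F m n| <= C / m%:R ^+ 2 * g (n%:R / m%:R).
Proof.
have [A A0 errA] := @err_le_expR R; have [C1 C10 medium] := err_le_medium.
have [K K0 HK] := buchstab_limit R.
have g16 := g_gt0 16.
pose C : R := A * expR 16 / g 16 + C1 + 10 ^+ 3 * (expR 2 + K).
have p1 : 0 < A * expR 16 / g 16 by rewrite divr_gt0 ?mulr_gt0 ?expR_gt0.
have p2 : 0 < 10 ^+ 3 * (expR 2 + K) by rewrite mulr_gt0 ?addr_gt0 ?expR_gt0.
exists C; first by rewrite !addr_gt0.
move=> F m n m0 mn; have m0' : 0 < m%:R :> R by rewrite ltr0n.
have m1' : 1 <= m%:R :> R by rewrite ler1n.
have M0 : 0 <= m%:R ^- 2 :> R by rewrite invr_ge0 exprn_ge0.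
have gu := ltW (g_gt0 (n%:R / m%:R)).
have u1 : 1 <= n%:R / m%:R :> R by rewrite ler_pdivlMr// mul1r ler_nat ltnW.
have [m10|m10] := leqP 10 m.
  have [n16|n16] := leqP (16 * m) n.
    apply: (le_trans (medium F m n m10 n16)).
    by rewrite ler_wpM2r// ler_wpM2r// /C; lra.
  have u16 : n%:R / m%:R <= 16 :> R by rewrite ler_pdivrMr// -natrM ler_nat ltnW.
  have h : m%:R * `|err R F m n| <= A / m%:R * expR 16.
    apply: (@le_trans _ _ `|n%:R * err R F m n|).
      by rewrite normrM ler_wpM2r// ger0_norm// ler_nat ltnW.
    apply: (le_trans (errA F m n m0 mn)); rewrite ler_wpM2l ?ler_expR//.
    by rewrite divr_ge0// ltW.
  apply: (@le_trans _ _ (A * expR 16 / g 16 * m%:R ^- 2 * g 16)).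
    move: h; rewrite -ler_pdivlMl// => /le_trans; apply.
    by rewrite le_eqVlt; apply/orP; left; apply/eqP; field; rewrite !gt_eqF.
  apply: ler_pM; [by rewrite mulr_ge0 ?(ltW p1)|exact: ltW| |exact: g_le].
  by rewrite ler_wpM2r// /C; lra.
apply: (le_trans (err_sub_limit F n m0)).
have m10' : m%:R <= 10 :> R by rewrite ler_nat ltnW.
have h1 := rough_prop_sub_lambda_le F R m0 (ltnW mn).
have h2 := HK _ u1; set u : R := n%:R / m%:R in gu u1 h1 h2 *.
have guE : expR (u - u * ln u) = g u by congr expR; ring.
rewrite guE in h1.
have m3 : m%:R ^+ 3 <= 10 ^+ 3 :> R by rewrite lerXn2r ?nnegrE.
apply: (@le_trans _ _ ((expR 2 + K) * m%:R * g u)).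
  rewrite mulrDl mulrDl lerD//.
  apply: (@le_trans _ _ (1 * (K * G u))); first by rewrite ler_pM ?invr_ge0 ?invf_le1.
  rewrite mul1r -mulrA ler_wpM2l ?(ltW K0)// (@le_trans _ _ (g u))//.
    by apply: G_le_g; lra.
  by rewrite ler_peMl.
rewrite ler_wpM2r//.
have eK : 0 < expR 2 + K by rewrite addr_gt0 ?expR_gt0.
have -> : (expR 2 + K) * m%:R = (expR 2 + K) * m%:R ^+ 3 * m%:R ^- 2.
  by field; rewrite gt_eqF.
rewrite ler_wpM2r//; apply: (@le_trans _ _ (10 ^+ 3 * (expR 2 + K))).
  by rewrite mulrC ler_wpM2r// ltW.
by rewrite /C; lra.
Qed.

End error.

Lemma powR_weight (R : realType) (u : R) : 0 < u ->
  (u / expR 1) `^ (- u) = weight 0 u.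
Proof.
move=> u0; have e0 : 0 < u / expR 1 by rewrite divr_gt0 ?expR_gt0.
rewrite /powR gt_eqF// ln_div ?posrE ?expR_gt0// expRK /weight.
by congr expR; ring.
Qed.

Lemma expRN_norm_le (R : realType) (d : R) : 0 <= d -> `|expR (- d) - 1| <= d.
Proof.
move=> d0; rewrite distrC ger0_norm; last by rewrite subr_ge0 expR_le1 oppr_le0.
by have := expR_ge1Dx (- d); lra.
Qed.

Theorem theorem1p2 (R : realType) :
  exists C : R,
  forall (F : finFieldType) (n m : nat), (1 <= m)%N -> (m < n)%N ->
    let q : R := #|F|%:R in
    let u : R := n%:R / m%:R in
    [/\ exists2 t : R,
          `|t| <= C * ((u / expR 1) `^ (- u) / m%:R) &
          rough_prop F R n m =
            lambda F R m * expR (euler_gamma R) * buchstab u * (1 + t),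
        exists2 t : R,
          `|t| <= C * (m%:R * q `^ (m.+1%:R / 2))^-1 &
          lambda F R m = expR (- harm R m) * (1 + t) &
        exists2 t : R,
          `|t| <= C * m%:R^-1 &
          lambda F R m = expR (- euler_gamma R) / m%:R * (1 + t)].
Proof.
have [Ce Ce0 errC] := @err_le R.
have e5 : 0 < expR 5 :> R := expR_gt0 _.
have p0 : 0 < 2 * expR 5 * Ce by rewrite !mulr_gt0.
exists (2 * expR 5 * Ce + 8) => F n m m0 mn q u.
have m0' : 0 < m%:R :> R by rewrite ltr0n.
have u1 : 1 <= u by rewrite ler_pdivlMr// mul1r ler_nat ltnW.
have u0 : 0 < u by rewrite (lt_le_trans ltr01).
have C8 : 8 <= 2 * expR 5 * Ce + 8 by rewrite lerDr ltW.
split.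
- rewrite powR_weight//.
  have [k0 _ kl _] := kappa_bounds R F m0; rewrite -/u in kl.
  have eE := errC F m n m0 mn.
  have /andP[w2 _] := buchstab_bounds u1.
  have w0 : 0 < buchstab u by rewrite (lt_le_trans _ w2)// invr_gt0.
  set k : R := lambda F R m * expR (euler_gamma R) in k0 kl *.
  have rE : rough_prop F R n m = err R F m n + k * buchstab u.
    by rewrite /err -/k -/u subrK.
  have kw0 : 0 < k * buchstab u by rewrite mulr_gt0.
  exists (err R F m n / (k * buchstab u)); last first.
    by rewrite rE; field; rewrite !gt_eqF.
  have kw : expR (- 5) / m%:R / 2 <= k * buchstab u.
    by rewrite ler_pM// mulr_ge0 ?expR_ge0 ?invr_ge0.
  rewrite normrM normfV (gtr0_norm kw0) ler_pdivrMr//.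
  apply: (le_trans eE); rewrite -/u.
  have W0 := weight_gt0 0 u.
  apply: (@le_trans _ _ (2 * expR 5 * Ce * (weight 0 u / m%:R) * (expR (- 5) / m%:R / 2))).
    rewrite le_eqVlt; apply/orP; left; apply/eqP; rewrite expRN.
    by field; rewrite !gt_eqF.
  apply: ler_pM => //.
  - by rewrite !mulr_ge0 ?(ltW W0) ?invr_ge0 ?(ltW Ce0) ?expR_ge0.
  - by rewrite ler_wpM2r ?divr_ge0 ?(ltW W0)// lerDl.
- have /andP[d0 d8] := ln_lambda_bounds F R m0.
  set d := - ln (lambda F R m) - harm R m in d0 d8.
  exists (expR (- d) - 1); last first.
    rewrite addrC subrK -expRD /d opprB opprK addrA addNr add0r.
    by rewrite lnK ?posrE ?lambda_gt0.
  apply: (le_trans (expRN_norm_le d0)); apply: (le_trans d8).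
  have q2 := q_ge2 F R; have q0 := q_gt0 F R.
  have qh : q `^ (m.+1%:R / 2) <= q ^+ uphalf m.+1.
    rewrite -powR_mulrn ?(ltW q0)// ler_powR; first by [].
      by rewrite (le_trans _ q2)// ler1n.
    by rewrite ler_pdivrMr// -natrM ler_nat muln2 -leq_uphalf_double.
  rewrite -/q ler_pM ?invr_ge0 ?mulr_ge0 ?exprn_ge0 ?(ltW q0)//.
  rewrite lef_pV2 ?posrE ?mulr_gt0 ?powR_gt0 ?exprn_gt0//.
  by rewrite ler_wpM2l ?(ltW m0').
- have [d /andP[d0 d5] dE] := lambda_gamma F R m0.
  exists (expR (- d) - 1).
    apply: (le_trans (expRN_norm_le d0)); apply: (le_trans d5).
    by rewrite ler_wpM2r ?invr_ge0//; lra.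
  rewrite addrC subrK -dE expRN; field.
  by rewrite !gt_eqF// expR_gt0.
Qed.
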